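(* Let $A_n\in\mathbb{R}^{n\times n}$ be symmetric positive definite, let $P_n\in\mathbb{R}^{n\times n}$ be symmetric and invertible, and let $\mu$ be a probability distribution on the unit sphere $\mathbb{B}(\mathbb{R}^n)=\{\mathbf y\in\mathbb{R}^n : \|\mathbf y\|_2=1\}$. Let $\{\mathbf y_i\}_{i=1}^N$ be training data sampled independently from $\mu$, let $\mathbf x_i=A_n^{-1}\mathbf y_i$, let $C_n\ge \|A_n^{-1}\|_2$, let $\delta\ge 0$ and $\epsilon\in(0,1)$. For $\theta\in\Theta(C_n)$ let $\mathcal{N}_\theta$ be the two-layer ReLU network with parameter $\theta$, and let $\theta^*\in\Theta(C_n)$ be a $\delta$-minimizer over $\Theta(C_n)$ of the empirical loss $$\mathcal{L}^N_{\mathrm{emp}}(\theta)=\frac1N\sum_{i=1}^N\|P_n(\mathcal{N}_\theta(\mathbf y_i)-\mathbf x_i)\|_2^2 .$$ Then, with probability at least $1-\epsilon$ (over the training sample), $$\|\mathcal{N}_{\theta^*}-A_n^{-1}\|^2_{A_n,\mu}\le \|A_nP_n^{-2}\|_2\left(\frac{108\,n\,C_n^2\|P_n\|_F^2}{\sqrt N}+9C_n^2\|P_n\|_2^2\sqrt{\frac{2\log(2/\epsilon)}{N}}+\delta\right).$$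
   Context: Two-layer network: for $\theta=(c_1,c_2,W_1,W_2)$ with $c_j\in\mathbb{R}$ and $W_j\in\mathbb{R}^{n\times n}$, $\mathcal{N}_\theta:\mathbb{R}^n\to\mathbb{R}^n$ is $\mathcal{N}_\theta(\mathbf x)=\sum_{j=1}^2 c_j\,\mathrm{ReLU}(W_j\mathbf x)$, where $\mathrm{ReLU}(z)=\max\{z,0\}$ is applied componentwise. Parameter set: $\Theta(C_n)=\{(c_1,c_2,W_1,W_2) : |c_j|\le C_n,\ \|W_j\|_2\le 1,\ j=1,2\}$. Norms: for vectors, $\|\cdot\|_2$ is the Euclidean norm; for matrices, $\|\cdot\|_2$ is the spectral norm and $\|\cdot\|_F$ the Frobenius norm. For a symmetric positive definite matrix $B$, $\|\mathbf v\|_B^2=\mathbf v^\top B\mathbf v$. Error measure: $\|\mathcal{N}_\theta-A_n^{-1}\|^2_{A_n,\mu}=\mathbb{E}_{\mathbf y\sim\mu}\|\mathcal{N}_\theta(\mathbf y)-A_n^{-1}\mathbf y\|_{A_n}^2$, where for $\theta=\theta^*$ the expectation is over a fresh $\mathbf y\sim\mu$ with $\theta^*$ (which may depend on the training sample) held fixed. $\delta$-minimizer: $\mathbf x^*$ is a $\delta$-minimizer of a function $f$ (over a given domain) if $f(\mathbf x^* )\le\delta+\inf_{\mathbf x}f(\mathbf x)$, the infimum being over that domain. *)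

(* Defs.v *)
From HB Require Import structures.
From mathcomp Require Import all_boot all_order all_algebra.
From mathcomp Require Import all_classical all_reals all_analysis.
Set Implicit Arguments.
Unset Strict Implicit.
Unset Printing Implicit Defensive.
Import Order.TTheory GRing.Theory Num.Theory.
Import numFieldNormedType.Exports.
Local Open Scope classical_set_scope.
Local Open Scope ring_scope.

(* R^n with its Borel sigma-algebra; convertible to 'cV[R]_n. *)
Notation borelRn R n := (g_sigma_algebraType (@open 'cV[R]_n)).

Definition norm2 (R : realType) (n : nat) (v : 'cV[R]_n) : R :=
  Num.sqrt (\sum_(i < n) v i 0 ^+ 2).

Definition spectral_norm (R : realType) (n : nat) (B : 'M[R]_n) : R :=
  sup [set norm2 (B *m v) | v in [set v : 'cV[R]_n | norm2 v <= 1]].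

Definition frobenius_norm (R : realType) (n : nat) (B : 'M[R]_n) : R :=
  Num.sqrt (\sum_(i < n) \sum_(j < n) B i j ^+ 2).

(* The SQUARE of the norm induced by B. *)
Definition sqnorm_mx (R : realType) (n : nat) (B : 'M[R]_n) (v : 'cV[R]_n) : R :=
  (v^T *m B *m v) 0 0.

Definition spdmx (R : realType) (n : nat) (B : 'M[R]_n) : Prop :=
  B \is symmetricmx /\ forall v : 'cV[R]_n, v != 0 -> 0 < (v^T *m B *m v) 0 0.

Definition unit_sphere (R : realType) (n : nat) : set 'cV[R]_n :=
  [set y | norm2 y = 1].
Arguments unit_sphere : clear implicits.

Definition relu (R : realType) (n : nat) (x : 'cV[R]_n) : 'cV[R]_n :=
  map_mx (fun z => Num.max z 0) x.

(* theta = (c_1, c_2, W_1, W_2); the indices 1, 2 are the elements of 'I_2. *)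
Record theta_param (R : realType) (n : nat) := ThetaParam {
  coef : 'I_2 -> R;
  weight : 'I_2 -> 'M[R]_n }.

Definition network (R : realType) (n : nat) (theta : theta_param R n)
    (x : 'cV[R]_n) : 'cV[R]_n :=
  \sum_(j < 2) coef theta j *: relu (weight theta j *m x).

Definition theta_set (R : realType) (n : nat) (C : R) :
    set (theta_param R n) :=
  [set theta | forall j : 'I_2,
    `|coef theta j| <= C /\ spectral_norm (weight theta j) <= 1].
Arguments theta_set : clear implicits.

Definition empirical_loss (R : realType) (n N : nat) (P : 'M[R]_n)
    (x y : 'I_N -> 'cV[R]_n) (theta : theta_param R n) : R :=
  N%:R^-1 * \sum_(i < N) norm2 (P *m (network theta (y i) - x i)) ^+ 2.

(* [inf] is only meaningful when f is bounded below on the nonempty set D. *)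
Definition delta_minimizer (R : realType) (T : Type) (D : set T) (f : T -> R)
    (delta : R) (t : T) : Prop :=
  D t /\ f t <= delta + inf (f @` D).

Definition expected_sqerror (R : realType) (n : nat) (A : 'M[R]_n)
    (mu : probability (borelRn R n) R) (theta : theta_param R n) : \bar R :=
  (\int[mu]_y (sqnorm_mx A (network theta y - invmx A *m y))%:E)%E.

Definition mutually_independent (R : realType) (d d' : measure_display)
    (Omega : measurableType d) (T : measurableType d')
    (Pr : probability Omega R) (I : finType) (X : I -> {RV Pr >-> T}) : Prop :=
  forall (J : {set I}) (B : I -> set T), (forall i, measurable (B i)) ->
    (Pr (\bigcap_(i in [set` J]) (X i @^-1` B i)) =
     \prod_(i in J) Pr (X i @^-1` B i))%E.

Definition iid_sample (R : realType) (d d' : measure_display)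
    (Omega : measurableType d) (T : measurableType d')
    (Pr : probability Omega R) (mu : probability T R) (N : nat)
    (X : 'I_N -> {RV Pr >-> T}) : Prop :=
  mutually_independent X /\
  forall (i : 'I_N) (B : set T), measurable B -> distribution Pr (X i) B = mu B.

(* Main.v *)
Require Import Defs.
From HB Require Import structures.
From mathcomp Require Import all_boot all_order all_algebra.
From mathcomp Require Import all_classical all_reals all_analysis.
From mathcomp Require Import measurable_realfun ring lra.
Set Implicit Arguments.
Unset Strict Implicit.
Unset Printing Implicit Defensive.
Import Order.TTheory GRing.Theory Num.Theory.
Import numFieldNormedType.Exports.
Local Open Scope classical_set_scope.
Local Open Scope ring_scope.

(** In the variable [P v], the [A]-norm of a vector [v] is controlled by
    [spectral_norm (A P^-2)] times the squared Euclidean norm ([sqnorm_mx_le]), so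
    it suffices to bound the expected loss [sqloss], uniformly over the parameter
    set, by the empirical one.  Since [z = max z 0 - max (- z) 0], the target
    [A^-1] is itself a network of the class ([network_exact]); the infimum of the
    empirical loss is zero, and the loss of a [delta]-minimizer is at most [delta].

    The uniform deviation is bounded through Rademacher averages, kept finite
    throughout.  The sphere is cut into the cells of a grid of step [1/N]; the loss
    is Lipschitz, so replacing every point by a representative of its cell costs
    [O(1/N)], and independence makes the cells of the sample an i.i.d. sample from
    a finite probability space.  There are then finitely many samples, and choosing
    one violating parameter for each sample that violates the bound leaves a finite
    class of functions, with no supremum to measure
    ([discrete_generalization]).

    For a finite class, [symmetrization] compares the exponential moment of the
    largest deviation with that of a maximum of signed sums, whose mean [rad] is a
    Rademacher complexity; the bounded differences inequality
    ([signavg_expR_le]) and Chernoff's bound then give the term in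
    [ln (2 / eps)], the range of the loss being [9 C^2 spectral_norm P ^+ 2].
    The complexity itself is computed by [rad_contraction]: the square is Lipschitz
    on the range of each coordinate of the error, the error is a combination of
    [2 n] neurons and a linear map, and a neuron contracts a linear functional of
    norm at most one, whose signed sums have mean at most [Num.sqrt N]
    ([rad_linear]).  Every averaging argument is an induction that treats one sign
    or one sample point at a time. *)

(** * Averages over random signs *)

Lemma addfE (T : Type) (V : zmodType) (a b : T -> V) t : (a + b) t = a t + b t.
Proof. by []. Qed.

Lemma oppfE (T : Type) (V : zmodType) (a : T -> V) t : (- a) t = - a t.
Proof. by []. Qed.

(** The value [0] competes with the values of [a].  Hence [max0 a] and
    [max0 (- a)] together control [`|a t|], which absorbs coefficients of either
    sign, and the contraction principle takes its classical form, for functions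
    vanishing at [0]. *)
Definition max0 (R : realType) (T : finType) (a : T -> R) : R :=
  \big[Num.max/0]_t a t.

Section Max0.
Context {R : realType} {T : finType}.
Implicit Types a h g : T -> R.

Lemma max0_ge0 a : 0 <= max0 a.
Proof. exact: bigmax_ge_id. Qed.

Lemma le_max0 a t : a t <= max0 a.
Proof. exact: le_bigmax. Qed.

Lemma max0_leP a c : 0 <= c -> (forall t, a t <= c) -> max0 a <= c.
Proof. by move=> c0 ac; apply: bigmax_le => // t _; exact: ac. Qed.

Lemma max0D a g : max0 (a + g) <= max0 a + max0 g.
Proof.
apply: max0_leP => [|t]; first by rewrite addr_ge0 ?max0_ge0.
by rewrite lerD ?le_max0.
Qed.

Lemma max0Z c a : 0 <= c -> max0 (fun t => c * a t) <= c * max0 a.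
Proof.
move=> c0; apply: max0_leP => [|t]; first by rewrite mulr_ge0 ?max0_ge0.
by rewrite ler_wpM2l ?le_max0.
Qed.

Lemma max0_scale (c : T -> R) C a : (forall t, `|c t| <= C) ->
  max0 (fun t => c t * a t) <= C * (max0 a + max0 (- a)).
Proof.
move=> cC; apply: max0_leP => [|t].
  case: (pickP T) => [t _|T0].
    by rewrite mulr_ge0 ?addr_ge0 ?max0_ge0 // (le_trans _ (cC t)).
  by rewrite /max0 !big_pred0 ?addr0 ?mulr0 // => t; rewrite T0.
apply: (le_trans (ler_norm _)); rewrite normrM ler_pM //.
have := le_max0 a t; have := le_max0 (- a) t.
have := max0_ge0 a; have := max0_ge0 (- a).
rewrite oppfE ler_norml => *; apply/andP; split; lra.
Qed.

(** The mechanism of the contraction principle: after expanding the two maxima,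
    the pair [(t, s)] contributes [a t + a s + (h t - h s)], which is at most
    [a t + a s + `|g t - g s|], and the sign of [g t - g s] only decides which of
    [t] and [s] goes with [a + g].  The comparison [`|h| <= `|g|] is the same
    condition for the constant competitor [0]. *)
Lemma max0_contraction a h g :
  (forall t, `|h t| <= `|g t|) ->
  (forall t s, `|h t - h s| <= `|g t - g s|) ->
  max0 (a + h) + max0 (a - h) <= max0 (a + g) + max0 (a - g).
Proof.
move=> hg hhgg; set Q := (X in _ <= X).
have P1 := max0_ge0 (a + g); have P2 := max0_ge0 (a - g).
have Q1 t : a t + g t <= max0 (a + g) by exact: (le_max0 (a + g)).
have Q2 t : a t - g t <= max0 (a - g) by exact: (le_max0 (a - g)).
have single t : a t + `|h t| <= Q.
  have := hg t; have := Q1 t; have := Q2 t; rewrite /Q.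
  by case: (ler0P (g t)) => *; lra.
have pair t s : a t + h t + (a s - h s) <= Q.
  have := ler_norm (h t - h s); have := hhgg t s.
  have := Q1 t; have := Q2 t; have := Q1 s; have := Q2 s; rewrite /Q.
  by case: (ler0P (g t - g s)) => *; lra.
rewrite -lerBrDr; apply: max0_leP => [|t]; rewrite ?subr_ge0 ?lerBrDr.
  apply: max0_leP => [|s]; first by rewrite addr_ge0.
  have := single s; have := ler_norm (- h s); rewrite normrN.
  by rewrite addfE oppfE => *; lra.
rewrite -lerBrDl; apply: max0_leP => [|s]; rewrite ?subr_ge0 ?lerBrDl.
  by have := single t; have := ler_norm (h t); rewrite addfE => *; lra.
exact: pair.
Qed.

End Max0.

(** [signavg F h ys a] is the mean of [F (a + \sum_i e_i h (ys_i))] over uniform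
    independent signs [e_i]; with [F := max0] it is, up to normalisation, the
    Rademacher complexity of the class [h] on the sample [ys].  The recursion on
    the sample, with an arbitrary starting point [a], is what lets every
    property below be proved one sign at a time. *)
Fixpoint signavg (R : realType) (T X : Type) (F : (T -> R) -> R)
    (h : X -> T -> R) (ys : seq X) (a : T -> R) : R :=
  if ys is y :: ys' then
    2^-1 * (signavg F h ys' (a + h y) + signavg F h ys' (a - h y))
  else F a.

Section SignAverage.
Context {R : realType} {T : finType} {X : eqType}.
Implicit Types (h g : X -> T -> R) (ys : seq X) (a : T -> R).

Local Notation rad := (signavg (@max0 R T)).

Lemma signavg_map (Y : Type) (F : (T -> R) -> R) (h : X -> T -> R) (k : Y -> X)
    (ys : seq Y) a :
  signavg F h (map k ys) a = signavg F (h \o k) ys a.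
Proof. by elim: ys a => //= y ys IH a; rewrite !IH. Qed.

Lemma radD h g ys a b : rad (h + g) ys (a + b) <= rad h ys a + rad g ys b.
Proof.
elim: ys a b => [|y ys IH] a b /=; first exact: max0D.
have := IH (a + h y) (b + g y); have := IH (a - h y) (b - g y).
rewrite addfE opprD (addrACA a b (h y)) (addrACA a b (- h y)) => *; lra.
Qed.

Lemma rad_sum (J : finType) (h : J -> X -> T -> R) (c : J -> R) ys :
  (forall j, rad (h j) ys 0 <= c j) ->
  rad (\sum_j h j) ys 0 <= \sum_j c j.
Proof.
move=> hc; have rad0 : rad 0 ys 0 <= 0.
  elim: (ys) => [|y l IH] /=; first by apply: max0_leP => // t.
  by rewrite [(0 : X -> T -> R) y]/(0 : T -> R) oppr0 addr0; lra.
elim/big_ind2 : _ => // f x g y fx gy; rewrite -[X in rad _ _ X](addr0 0).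
exact: le_trans (radD _ _ _ _ _) (lerD fx gy).
Qed.

Lemma radZ h ys a c : 0 <= c ->
  rad (fun y t => c * h y t) ys (fun t => c * a t) <= c * rad h ys a.
Proof.
move=> c0; elim: ys a => [|y ys IH] a /=; first exact: max0Z.
have := IH (a + h y); have := IH (a - h y).
rewrite [X in rad _ _ X <= _](_ :
    _ = (fun t => c * a t) - (fun t => c * h y t)); last first.
  by apply/funext => t; rewrite [LHS]mulrBr.
rewrite [X in _ -> rad _ _ X <= _ -> _](_ :
    _ = (fun t => c * a t) + (fun t => c * h y t)); last first.
  by apply/funext => t; rewrite [LHS]mulrDr.
by move=> *; lra.
Qed.

(** A coefficient depending on [t] may have either sign, and so costs the
    complexity of both [h] and [- h]. *)
Lemma rad_scale (c : T -> R) C h ys a : (forall t, `|c t| <= C) ->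
  rad (fun y t => c t * h y t) ys (fun t => c t * a t) <=
  C * (rad h ys a + rad (- h) ys (- a)).
Proof.
move=> cC; elim: ys a => [|y ys IH] a /=; first exact: max0_scale.
have := IH (a + h y); have := IH (a - h y).
rewrite [X in rad _ _ X <= _](_ :
    _ = (fun t => c t * a t) - (fun t => c t * h y t)); last first.
  by apply/funext => t; rewrite [LHS]mulrBr.
rewrite [X in _ -> rad _ _ X <= _ -> _](_ :
    _ = (fun t => c t * a t) + (fun t => c t * h y t)); last first.
  by apply/funext => t; rewrite [LHS]mulrDr.
rewrite oppfE opprK opprB opprD (addrC (h y)).
by rewrite !mulrDr => *; lra.
Qed.

(** An inequality for one random sign survives the averaging over later signs. *)
Lemma signavg_le (F : (T -> R) -> R) h g y ys :
  (forall a, F (a + h y) + F (a - h y) <= F (a + g y) + F (a - g y)) ->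
  forall a, signavg F g ys (a + h y) + signavg F g ys (a - h y) <=
            signavg F g ys (a + g y) + signavg F g ys (a - g y).
Proof.
move=> Fhg; elim: ys => [|z ys IH] a //=.
have := IH (a + g z); have := IH (a - g z).
rewrite !(addrAC a (g z)) !(addrAC a (- g z)) => *; lra.
Qed.

(** The contraction principle of Ledoux and Talagrand, one sign at a time.  The
    usual Lipschitz function [phi] with [phi 0 = 0] and [h = phi \o g] only
    enters through the two inequalities assumed here. *)
Lemma rad_contraction h g ys a :
  {in ys, forall y t, `|h y t| <= `|g y t|} ->
  {in ys, forall y t s, `|h y t - h y s| <= `|g y t - g y s|} ->
  rad h ys a <= rad g ys a.
Proof.
elim: ys a => [|y ys IH] a //= hg hhgg.
have {}IH b : rad h ys b <= rad g ys b.
  by apply: IH => z zys; [apply: hg|apply: hhgg]; rewrite inE zys orbT.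
apply: (@le_trans _ _ (2^-1 * (rad g ys (a + h y) + rad g ys (a - h y)))).
  by have := IH (a + h y); have := IH (a - h y) => *; lra.
rewrite ler_wpM2l ?invr_ge0 ?ler0n //; apply: signavg_le => b.
by apply: max0_contraction; [apply: hg|apply: hhgg]; rewrite mem_head.
Qed.

End SignAverage.

(** * Euclidean and spectral norms *)

Section EuclideanNorm.
Context {R : realType}.

Definition dot n (u v : 'cV[R]_n) : R := \sum_i u i 0 * v i 0.

Lemma sqr_norm2 n (v : 'cV[R]_n) : norm2 v ^+ 2 = \sum_i v i 0 ^+ 2.
Proof. by rewrite sqr_sqrtr // sumr_ge0 // => i _; rewrite sqr_ge0. Qed.

Lemma norm2_ge0 n (v : 'cV[R]_n) : 0 <= norm2 v.
Proof. exact: sqrtr_ge0. Qed.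

Lemma dot_norm2 n (v : 'cV[R]_n) : dot v v = norm2 v ^+ 2.
Proof. by rewrite sqr_norm2; apply: eq_bigr => i _; rewrite expr2. Qed.

Lemma mul_tr_col n (u v : 'cV[R]_n) : (u^T *m v) 0 0 = dot u v.
Proof. by rewrite mxE; apply: eq_bigr => i _; rewrite mxE. Qed.

Lemma dotDr n (u v w : 'cV[R]_n) : dot u (v + w) = dot u v + dot u w.
Proof. by rewrite -big_split; apply: eq_bigr => i _; rewrite /= mxE mulrDr. Qed.

Lemma dotNr n (u v : 'cV[R]_n) : dot u (- v) = - dot u v.
Proof. by rewrite -sumrN; apply: eq_bigr => i _; rewrite mxE mulrN. Qed.

(** Lagrange's identity gives the Cauchy-Schwarz inequality without dividing. *)
Lemma sqr_dot_le n (u v : 'cV[R]_n) : dot u v ^+ 2 <= norm2 u ^+ 2 * norm2 v ^+ 2.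
Proof.
have : 0 <= \sum_i \sum_j (u i 0 * v j 0 - u j 0 * v i 0) ^+ 2.
  by apply: sumr_ge0 => i _; apply: sumr_ge0 => j _; rewrite sqr_ge0.
rewrite (_ : (\sum_i _) =
  2 * (norm2 u ^+ 2 * norm2 v ^+ 2) - 2 * dot u v ^+ 2); first by move=> ?; lra.
pose a i := u i 0; pose b i := v i 0.
have cross (f g : 'I_n -> R) : \sum_i \sum_j f i * g j = (\sum_i f i) * (\sum_j g j).
  by rewrite big_distrl /=; apply: eq_bigr => i _; rewrite big_distrr.
transitivity (\sum_i \sum_j a i ^+ 2 * b j ^+ 2 + \sum_i \sum_j b i ^+ 2 * a j ^+ 2
   - 2 * \sum_i \sum_j (a i * b i) * (a j * b j)).
  rewrite mulr_sumr -sumrN -!big_split /=.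
  apply: eq_bigr => i _; rewrite mulr_sumr -sumrN -!big_split /=.
  by apply: eq_bigr => j _; rewrite /a /b; ring.
by rewrite !cross !sqr_norm2 /dot; ring.
Qed.

Lemma dot_le n (u v : 'cV[R]_n) : `|dot u v| <= norm2 u * norm2 v.
Proof.
rewrite -(@ler_pXn2r _ 2) ?nnegrE ?mulr_ge0 ?norm2_ge0 //.
by rewrite real_normK ?num_real // exprMn sqr_dot_le.
Qed.

Lemma sqr_norm2D n (u v : 'cV[R]_n) :
  norm2 (u + v) ^+ 2 = norm2 u ^+ 2 + 2 * dot u v + norm2 v ^+ 2.
Proof.
rewrite !sqr_norm2 /dot mulr_sumr -!big_split /=.
by apply: eq_bigr => i _; rewrite mxE; ring.
Qed.

Lemma norm2D n (u v : 'cV[R]_n) : norm2 (u + v) <= norm2 u + norm2 v.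
Proof.
rewrite -(@ler_pXn2r _ 2) ?nnegrE ?addr_ge0 ?norm2_ge0 // sqr_norm2D.
have := dot_le u v; have := ler_norm (dot u v) => *.
by rewrite sqrrD; lra.
Qed.

Lemma norm2Z n c (u : 'cV[R]_n) : norm2 (c *: u) = `|c| * norm2 u.
Proof.
rewrite /norm2 -sqrtr_sqr -sqrtrM ?sqr_ge0 // mulr_sumr.
by congr Num.sqrt; apply: eq_bigr => i _; rewrite mxE exprMn.
Qed.

Lemma norm2N n (u : 'cV[R]_n) : norm2 (- u) = norm2 u.
Proof. by rewrite -scaleN1r norm2Z normrN1 mul1r. Qed.

Lemma norm20 n : norm2 (0 : 'cV[R]_n) = 0.
Proof. by rewrite -(scale0r 0) norm2Z normr0 mul0r. Qed.

Lemma norm2B n (u v : 'cV[R]_n) : norm2 (u - v) <= norm2 u + norm2 v.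
Proof. by rewrite -(norm2N v) norm2D. Qed.

Lemma norm2_sum (I : finType) n (u : I -> 'cV[R]_n) :
  norm2 (\sum_i u i) <= \sum_i norm2 (u i).
Proof.
elim/big_ind2 : _ => [|x x' y y' hx hy|//]; first by rewrite norm20.
exact: le_trans (norm2D _ _) (lerD hx hy).
Qed.

Lemma coord_le_norm2 n (u : 'cV[R]_n) i : `|u i 0| <= norm2 u.
Proof.
rewrite -(@ler_pXn2r _ 2) ?nnegrE ?norm2_ge0 // real_normK ?num_real //.
by rewrite sqr_norm2 (bigD1 i) //= lerDl sumr_ge0 // => j _; rewrite sqr_ge0.
Qed.

Lemma le_norm2 n (u v : 'cV[R]_n) : (forall i, `|u i 0| <= `|v i 0|) ->
  norm2 u <= norm2 v.
Proof.
move=> uv; rewrite ler_wsqrtr // ler_sum // => i _.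
by rewrite -[_ u i 0 ^+ 2]real_normK ?num_real // -[leRHS]real_normK ?num_real // lerXn2r ?nnegrE.
Qed.

(** The triangle inequality over the coordinates; the sharp factor would be
    [Num.sqrt n]. *)
Lemma norm2_le_coord n (u : 'cV[R]_n) r : (forall i, `|u i 0| <= r) ->
  norm2 u <= n%:R * r.
Proof.
move=> ur; rewrite (_ : u = \sum_i u i 0 *: delta_mx i 0); last first.
  apply/matrixP => i j; rewrite summxE (bigD1 i) //= big1 ?addr0.
    by rewrite !mxE !ord1 !eqxx mulr1.
  by move=> k ki; rewrite !mxE !ord1 eqxx eq_sym (negbTE ki) mulr0.
apply: (le_trans (norm2_sum _)).
rewrite [leRHS](_ : _ = \sum_(i < n) r); last by rewrite sumr_const card_ord mulr_natl.
apply: ler_sum => i _; rewrite norm2Z.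
rewrite (_ : norm2 _ = 1) ?mulr1 // -(sqrtr1 R) /norm2; congr Num.sqrt.
rewrite (bigD1 i) //= big1 ?addr0 ?mxE ?eqxx ?expr1n //.
by move=> k ki; rewrite mxE (negbTE ki) expr0n.
Qed.

Lemma norm2_eq0 n (u : 'cV[R]_n) : norm2 u = 0 -> u = 0.
Proof.
move=> u0; apply/matrixP => i j; rewrite !mxE ord1.
by apply/eqP; rewrite -normr_le0 -u0 coord_le_norm2.
Qed.

Definition rowv m n (B : 'M[R]_(m, n)) (k : 'I_m) : 'cV[R]_n := (row k B)^T.

Lemma mulmx_rowv m n (B : 'M[R]_(m, n)) (v : 'cV[R]_n) k :
  (B *m v) k 0 = dot (rowv B k) v.
Proof. by rewrite mxE; apply: eq_bigr => j _; rewrite !mxE. Qed.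

Lemma sqr_frobenius n (B : 'M[R]_n) :
  frobenius_norm B ^+ 2 = \sum_k norm2 (rowv B k) ^+ 2.
Proof.
rewrite sqr_sqrtr; last by rewrite sumr_ge0 // => i _; rewrite sumr_ge0 // => j _; rewrite sqr_ge0.
by apply: eq_bigr => k _; rewrite sqr_norm2; apply: eq_bigr => j _; rewrite !mxE.
Qed.

Lemma norm2_mulmx_frobenius n (B : 'M[R]_n) (v : 'cV[R]_n) :
  norm2 (B *m v) <= frobenius_norm B * norm2 v.
Proof.
rewrite -(@ler_pXn2r _ 2) ?nnegrE ?mulr_ge0 ?norm2_ge0 ?sqrtr_ge0 //.
rewrite exprMn sqr_frobenius mulr_suml sqr_norm2 ler_sum // => k _.
by rewrite mulmx_rowv sqr_dot_le.
Qed.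

Section Spectral.
Context {n : nat}.
Implicit Types B : 'M[R]_n.

Let img B := [set norm2 (B *m v) | v in [set v : 'cV[R]_n | norm2 v <= 1]].

Let img_ub B : has_ubound (img B).
Proof.
exists (frobenius_norm B) => _ [v /= v1 <-].
by rewrite (le_trans (norm2_mulmx_frobenius _ _)) // ler_piMr ?sqrtr_ge0.
Qed.

Let img0 B : img B 0.
Proof. by exists 0; rewrite /= ?norm20 ?mulmx0 ?norm20 ?ler01. Qed.

Lemma spectral_norm_ge0 B : 0 <= spectral_norm B.
Proof. exact: (ub_le_sup (img_ub B) (img0 B)). Qed.

(** The spectral norm is a supremum over the unit ball; this and [norm2_mulmx]
    are the two halves of its characterisation as the least Lipschitz constant. *)
Lemma spectral_norm_le B c : (forall v : 'cV[R]_n, norm2 (B *m v) <= c * norm2 v) ->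
  0 <= c -> spectral_norm B <= c.
Proof.
move=> Bc c0; apply: ge_sup => [|_ [v /= v1 <-]]; first by exists 0; exact: img0.
by rewrite (le_trans (Bc _)) // ler_piMr.
Qed.

Lemma norm2_mulmx B (v : 'cV[R]_n) : norm2 (B *m v) <= spectral_norm B * norm2 v.
Proof.
have [v0|v0] := eqVneq (norm2 v) 0.
  by rewrite v0 mulr0 (norm2_eq0 v0) mulmx0 norm20.
have vgt0 : 0 < norm2 v by rewrite lt_neqAle eq_sym v0 norm2_ge0.
rewrite -ler_pdivrMr // mulrC -[X in X * _]ger0_norm ?invr_ge0 ?norm2_ge0 //.
rewrite -norm2Z scalemxAr; apply: (ub_le_sup (img_ub B)).
exists ((norm2 v)^-1 *: v) => //=.
by rewrite norm2Z ger0_norm ?invr_ge0 ?norm2_ge0 // mulVf.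
Qed.

Lemma spectral_le_frobenius B : spectral_norm B <= frobenius_norm B.
Proof. by apply: spectral_norm_le => [v|]; [exact: norm2_mulmx_frobenius|exact: sqrtr_ge0]. Qed.

(** Apply [B] to the row [w] itself: the [k]-th coordinate of [B w] is
    [norm2 w ^+ 2]. *)
Lemma rowv_le_spectral B k : norm2 (rowv B k) <= spectral_norm B.
Proof.
set w := rowv B k.
have : norm2 w ^+ 2 <= spectral_norm B * norm2 w.
  rewrite -dot_norm2 -mulmx_rowv (le_trans (ler_norm _)) //.
  exact: le_trans (coord_le_norm2 _ _) (norm2_mulmx _ _).
have [->|w0] := eqVneq (norm2 w) 0; first by rewrite spectral_norm_ge0.
by rewrite expr2 ler_pM2r // lt_neqAle eq_sym w0 norm2_ge0.
Qed.

Lemma spectral_norm_gt0 B (v : 'cV[R]_n) : B *m v != 0 -> 0 < spectral_norm B.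
Proof.
move=> Bv0; rewrite lt_neqAle spectral_norm_ge0 andbT eq_sym.
apply: contra Bv0 => /eqP B0; apply/eqP/norm2_eq0/eqP; rewrite eq_le norm2_ge0 andbT.
by have := norm2_mulmx B v; rewrite B0 mul0r.
Qed.

End Spectral.

(** Exponential growth rates can be compared along the powers of two, whatever
    the factor [c]: if [k < x] then [(x / k) ^+ m] outgrows [c] by Bernoulli's
    inequality. *)
Lemma le_of_powers (x k c : R) : 0 <= x -> 0 <= k ->
  (forall j, x ^+ (2 ^ j) <= c * k ^+ (2 ^ j)) -> x <= k.
Proof.
move=> x0 k0 h; rewrite leNgt; apply/negP => kx.
have [kE|kn0] := eqVneq k 0.
  by have := h 0%N; rewrite kE expn0 !expr1 mulr0 leNgt (le_lt_trans k0).
have kgt0 : 0 < k by rewrite lt_neqAle eq_sym kn0.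
pose d := x / k - 1.
have d0 : 0 < d by rewrite subr_gt0 ltr_pdivlMr // mul1r.
have bern m : m%:R * d <= (x / k) ^+ m.
  have bern1 : 1 + m%:R * d <= (x / k) ^+ m.
    elim: m => [|m IH]; first by rewrite expr0 mul0r addr0.
    have xkE : x / k = 1 + d by rewrite /d addrC subrK.
    have d1 : 0 <= 1 + d by rewrite addr_ge0 // ltW.
    rewrite exprS {1}xkE; apply: le_trans (ler_wpM2l d1 IH).
    rewrite -natr1; have : 0 <= m%:R * d * d by rewrite !mulr_ge0 // ltW.
    by move=> ?; nra.
  by rewrite (le_trans _ bern1) // lerDr.
have [m hm] : exists m : nat, c / d < m%:R.
  by exists (Num.truncn (c / d)).+1; rewrite truncnS_gt.
have := bern (2 ^ m)%N; rewrite expr_div_n.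
have := h m; rewrite -ler_pdivrMr ?exprn_gt0 // => h1 h2.
have := le_trans h2 h1; rewrite leNgt => /negP; apply.
rewrite -ltr_pdivrMr // (lt_le_trans hm) // ler_nat ltnW // ltn_expl //.
Qed.

(** A symmetric [S] is bounded by the spectral norm of any matrix [K] similar to
    it, although that norm is not invariant under similarity: since [S] is
    symmetric, [norm2 (S u) ^+ 2 <= norm2 (S ^+ 2 u)] for unit [u], and iterating
    leaves only the growth rate of the powers of [S], which is that of [K]. *)
Lemma norm2_symmetric_similar n (P S K : 'M[R]_n) (u : 'cV[R]_n) :
  P \in unitmx -> S^T = S -> P *m S = K *m P ->
  norm2 (S *m u) <= spectral_norm K * norm2 u.
Proof.
move=> Pu Ssym PS.
have unit_case (v : 'cV[R]_n) : norm2 v = 1 -> norm2 (S *m v) <= spectral_norm K.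
  move=> v1; apply: (@le_of_powers _ _ (spectral_norm (invmx P) * norm2 (P *m v))).
  - exact: norm2_ge0.
  - exact: spectral_norm_ge0.
  have : forall w, norm2 (K *m w) <= spectral_norm K * norm2 w by exact: norm2_mulmx.
  have := spectral_norm_ge0 K; move: (spectral_norm K) => k k0 Kk j.
  elim: j S K k k0 Kk Ssym PS => [|j IH] S' K' k k0 Kk S'sym PS'.
    rewrite expn0 !expr1 (_ : S' *m v = invmx P *m (K' *m (P *m v))); last first.
      by rewrite !mulmxA -(mulmxA _ K') -PS' mulmxA mulVmx // mul1mx.
    rewrite (le_trans (norm2_mulmx _ _)) // -mulrA (mulrC _ k).
    by rewrite ler_wpM2l ?spectral_norm_ge0.
  have S2 : norm2 (S' *m v) ^+ 2 <= norm2 (S' *m S' *m v).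
    have -> : norm2 (S' *m v) ^+ 2 = dot v (S' *m S' *m v).
      by rewrite -dot_norm2 -!mul_tr_col trmx_mul S'sym !mulmxA.
    by rewrite (le_trans (ler_norm _)) // (le_trans (dot_le _ _)) // v1 mul1r.
  rewrite expnS !exprM.
  apply: (le_trans (lerXn2r _ _ _ S2)); rewrite ?nnegrE ?sqr_ge0 ?norm2_ge0 //.
  apply: (IH _ (K' *m K')) => [|w||].
  - exact: sqr_ge0.
  - by rewrite -mulmxA (le_trans (Kk _)) // expr2 -mulrA ler_wpM2l.
  - by rewrite trmx_mul S'sym.
  - by rewrite mulmxA PS' -mulmxA PS' mulmxA.
have [u0|u0] := eqVneq (norm2 u) 0.
  by rewrite (norm2_eq0 u0) mulmx0 !norm20 mulr0.
have ugt0 : 0 < norm2 u by rewrite lt_neqAle eq_sym u0 norm2_ge0.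
rewrite -ler_pdivrMr // mulrC -[X in X * _]ger0_norm ?invr_ge0 ?norm2_ge0 //.
rewrite -norm2Z scalemxAr unit_case //.
by rewrite norm2Z ger0_norm ?invr_ge0 ?norm2_ge0 // mulVf.
Qed.

Lemma trmx_symmetricmx n (A : 'M[R]_n) : A \is symmetricmx -> A^T = A.
Proof.
by rewrite qualifE /= expr0 scale1r => /eqP {2}->; apply/matrixP => i j; rewrite !mxE.
Qed.

(** In the variable [P v] the quadratic form of [A] has the symmetric matrix
    [P^-1 A P^-1], which is conjugate by [P] to [A P^-2]. *)
Lemma sqnorm_mx_le n (A P : 'M[R]_n) (v : 'cV[R]_n) :
  A \is symmetricmx -> P \is symmetricmx -> P \in unitmx ->
  sqnorm_mx A v <=
  spectral_norm (A *m (invmx P *m invmx P)) * norm2 (P *m v) ^+ 2.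
Proof.
move=> /trmx_symmetricmx At /trmx_symmetricmx Pt Pu.
set K := A *m _; pose S := invmx P *m A *m invmx P.
have Vt : (invmx P)^T = invmx P by rewrite trmx_inv Pt.
have vE : v = invmx P *m (P *m v) by rewrite mulmxA mulVmx // mul1mx.
have -> : sqnorm_mx A v = dot (P *m v) (S *m (P *m v)).
  rewrite /sqnorm_mx {1 2}vE -mul_tr_col trmx_mul Vt /S; congr (fun_of_matrix _ _ _).
  by rewrite !mulmxA.
rewrite (le_trans (ler_norm _)) // (le_trans (dot_le _ _)) //.
rewrite mulrC expr2 mulrA ler_wpM2r ?norm2_ge0 //.
apply: (norm2_symmetric_similar _ Pu); first by rewrite /S !trmx_mul Vt At mulmxA.
by rewrite /S /K !mulmxA mulmxV // mul1mx -!mulmxA mulVmx // mulmx1.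
Qed.

End EuclideanNorm.

(** * Exponential moments of averages over signs *)

Section Exponential.
Context {R : realType}.

Lemma le_of_derive_ge0 (f df : R -> R) (x : R) :
  (forall z : R, is_derive z 1 f (df z)) -> (forall z, 0 <= z -> 0 <= df z) ->
  0 <= x -> f 0 <= f x.
Proof.
move=> fdf df0 x0; have [|c cx fE] := MVT_segment x0 (fun z _ => fdf z).
  apply/continuous_subspaceT => z.
  by apply/differentiable_continuous/derivable1_diffP; have [] := fdf z.
by rewrite -subr_ge0 fE subr0 mulr_ge0 // df0 //; move: cx; rewrite in_itv => /andP[].
Qed.

(** The moment generating function of a random sign is subgaussian with
    variance one: [x cosh x - sinh x] vanishes at [0] and has derivative
    [x sinh x], and its sign makes [cosh x * exp (- x^2/2)] decrease. *)
Lemma cosh_le (x : R) : expR x + expR (- x) <= 2 * expR (x ^+ 2 / 2).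
Proof.
wlog x0 : x / 0 <= x.
  move=> wl; have [/wl //|x0] := lerP 0 x.
  by have := wl (- x); rewrite opprK sqrrN oppr_ge0 (addrC (expR (- x))); apply; exact: ltW.
have shc (z : R) : 0 <= z -> 0 <= z * (expR z + expR (- z)) - (expR z - expR (- z)).
  move=> z0; pose s (w : R) : R := w * (expR w + expR (- w)) - (expR w - expR (- w)).
  have s0 : s 0 = 0 by rewrite /s oppr0 mul0r !subrr.
  suff : s 0 <= s z by rewrite s0.
  apply: (@le_of_derive_ge0 s (fun w => w * (expR w - expR (- w)))) => // [w|w w0].
    by apply: is_derive_eq; rewrite /GRing.scale /=; ring.
  by rewrite mulr_ge0 // subr_ge0 ler_expR; lra.
pose q (w : R) : R := - ((expR w + expR (- w)) * expR (- (w ^+ 2 / 2))).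
have : q 0 <= q x.
  apply: (@le_of_derive_ge0 q (fun w =>
    (w * (expR w + expR (- w)) - (expR w - expR (- w))) * expR (- (w ^+ 2 / 2)))) => // [w|w w0].
    by apply: is_derive_eq; rewrite /GRing.scale /=; field.
  by rewrite mulr_ge0 ?expR_ge0 ?shc.
rewrite /q oppr0 expR0 expr0n /= mul0r oppr0 expR0 lerN2 (expRN (x ^+ 2 / 2)) ler_pdivrMr ?expR_gt0 //.
by rewrite (_ : (1 + 1) * 1 = 2) //; ring.
Qed.

Lemma expR_midpoint (x y : R) :
  2^-1 * (expR x + expR y) <= expR ((x + y) / 2 + (x - y) ^+ 2 / 8).
Proof.
have := cosh_le ((x - y) / 2).
rewrite (_ : ((x - y) / 2) ^+ 2 / 2 = (x - y) ^+ 2 / 8); last by field.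
rewrite expRD => h; have e0 := expR_gt0 ((x + y) / 2).
have -> : expR x = expR ((x + y) / 2) * expR ((x - y) / 2).
  by rewrite -expRD; congr expR; field.
have -> : expR y = expR ((x + y) / 2) * expR (- ((x - y) / 2)).
  by rewrite -expRD; congr expR; field.
rewrite -mulrDr mulrCA ler_wpM2l ?expR_ge0 //; lra.
Qed.

Context {T : finType} {X : eqType}.
Implicit Types (h : X -> T -> R) (ys : seq X) (a : T -> R).

Local Notation rad := (signavg (@max0 R T)).

Lemma rad_lipschitz h ys a g (c : R) : 0 <= c -> (forall t, g t <= c) ->
  rad h ys (a + g) <= rad h ys a + c.
Proof.
move=> c0 gc; elim: ys a => [|y ys IH] a /=.
  by apply: le_trans (max0D _ _) _; rewrite lerD2l; exact: max0_leP.
by have := IH (a + h y); have := IH (a - h y); rewrite !(addrAC a g) => *; lra.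
Qed.

(** The bounded differences inequality, one sign at a time: flipping the sign of
    [h y] moves the conditional mean [rad] by at most [2 * b]. *)
Lemma signavg_expR_le h ys a (lam b : R) : 0 <= lam ->
  {in ys, forall y t, `|h y t| <= b} ->
  signavg (fun v => expR (lam * max0 v)) h ys a <=
  expR (lam * rad h ys a + (size ys)%:R * (lam * b) ^+ 2 / 2).
Proof.
move=> lam0; elim: ys a => [|y ys IH] a hb /=; first by rewrite !mul0r addr0.
have {}IH v := IH v (sub_in1 (@mem_behead _ (y :: ys)) hb).
set C := (size ys)%:R * (lam * b) ^+ 2 / 2 in IH *.
set x := rad h ys (a + h y); set z := rad h ys (a - h y).
have xz : (x - z) ^+ 2 <= (2 * b) ^+ 2.
  have [t _|T0] := pickP T; last first.
    have -> : x = z by congr signavg; apply/funext => t; have := T0 t.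
    by rewrite subrr expr0n sqr_ge0.
  have hyb s : `|h y s| <= b by apply: hb; rewrite mem_head.
  have b0 : 0 <= b by exact: le_trans (hyb t).
  have side s : - b <= h y s <= b by rewrite -ler_norml.
  have b20 : 0 <= 2 * b by rewrite mulr_ge0.
  have xle : x <= z + 2 * b.
    rewrite (_ : x = rad h ys (a - h y + (h y + h y))); last by rewrite addrA subrK.
    by apply: rad_lipschitz => // s; rewrite addfE; have := side s; lra.
  have zle : z <= x + 2 * b.
    rewrite (_ : z = rad h ys (a + h y + (- h y - h y))); last by rewrite addrA addrK.
    by apply: rad_lipschitz => // s; rewrite addfE oppfE; have := side s; lra.
  rewrite -(real_normK (num_real (x - z))) lerXn2r ?nnegrE //.
  by rewrite ler_norml; apply/andP; split; lra.
apply: (@le_trans _ _ (2^-1 * (expR (lam * x + C) + expR (lam * z + C)))).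
  by have := IH (a + h y); have := IH (a - h y); rewrite -/x -/z; lra.
apply: le_trans (expR_midpoint _ _) _; rewrite ler_expR.
have -> : (size ys).+1%:R * (lam * b) ^+ 2 / 2 = C + (lam * b) ^+ 2 / 2.
  by rewrite -natr1 /C; ring.
have lxz : lam ^+ 2 * (x - z) ^+ 2 <= lam ^+ 2 * (2 * b) ^+ 2.
  by rewrite ler_wpM2l ?sqr_ge0.
have -> : lam * x + C - (lam * z + C) = lam * (x - z) by ring.
by rewrite !exprMn in lxz *; lra.
Qed.

(** In the class [w t] of linear functionals bounded by one, the maximum over
    [t] of a signed sum is at most the norm of the signed sum of the vectors,
    whose mean square is the sum of the squared norms. *)
Lemma rad_linear n (w : T -> 'cV[R]_n) (v : X -> 'cV[R]_n) ys (r : R) :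
  (forall t, norm2 (w t) <= 1) -> 0 <= r -> {in ys, forall y, norm2 (v y) <= r} ->
  rad (fun y t => dot (w t) (v y)) ys 0 <= r * Num.sqrt (size ys)%:R.
Proof.
move=> w1 r0 vr.
suff gen u : rad (fun y t => dot (w t) (v y)) ys (fun t => dot (w t) u) <=
    Num.sqrt (norm2 u ^+ 2 + (size ys)%:R * r ^+ 2).
  rewrite (_ : 0 = fun t => dot (w t) 0); last first.
    by apply/funext => t; rewrite /dot big1 // => i _; rewrite mxE mulr0.
  apply: (le_trans (gen _)).
  by rewrite norm20 expr0n add0r sqrtrM ?ler0n // mulrC sqrtr_sqr ger0_norm.
elim: ys vr u => [|y ys IH] vr u /=.
  rewrite mul0r addr0 sqrtr_sqr ger0_norm ?norm2_ge0 //.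
  apply: max0_leP => [|t]; first exact: norm2_ge0.
  rewrite (le_trans (ler_norm _)) // (le_trans (dot_le _ _)) //.
  by rewrite ler_piMl ?norm2_ge0.
have {}IH := IH (sub_in1 (@mem_behead _ (y :: ys)) vr).
set S := (size ys)%:R * r ^+ 2 in IH.
have -> : (size ys).+1%:R * r ^+ 2 = S + r ^+ 2 by rewrite -natr1 /S; ring.
set x := norm2 (u + v y) ^+ 2 + S; set z := norm2 (u - v y) ^+ 2 + S.
have S0 : 0 <= S by rewrite mulr_ge0 ?sqr_ge0.
have x0 : 0 <= x by rewrite addr_ge0 ?sqr_ge0.
have z0 : 0 <= z by rewrite addr_ge0 ?sqr_ge0.
have xz : x + z <= 2 * (norm2 u ^+ 2 + (S + r ^+ 2)).
  rewrite /x /z !sqr_norm2D norm2N dotNr.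
  have : norm2 (v y) ^+ 2 <= r ^+ 2 by rewrite lerXn2r ?nnegrE ?norm2_ge0 ?vr ?mem_head.
  by move=> ?; lra.
apply: (@le_trans _ _ (2^-1 * (Num.sqrt x + Num.sqrt z))).
  have := IH (u + v y); have := IH (u - v y); rewrite -/x -/z.
  rewrite (_ : (fun t => dot (w t) (u - v y)) =
    (fun t => dot (w t) u) - (fun t => dot (w t) (v y))); last first.
    by apply/funext => t; rewrite dotDr dotNr.
  rewrite (_ : (fun t => dot (w t) (u + v y)) =
    (fun t => dot (w t) u) + (fun t => dot (w t) (v y))); last first.
    by apply/funext => t; rewrite dotDr.
  by move=> *; lra.
rewrite -(@ler_pXn2r _ 2) ?nnegrE ?sqrtr_ge0 ?mulr_ge0 ?addr_ge0 ?sqrtr_ge0 ?sqr_ge0 //.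
rewrite sqr_sqrtr ?addr_ge0 ?sqr_ge0 //.
have := sqr_ge0 (Num.sqrt x - Num.sqrt z).
have := sqr_sqrtr x0; have := sqr_sqrtr z0.
move: (Num.sqrt x) (Num.sqrt z) => sx sz; rewrite !expr2 => *; lra.
Qed.

Lemma rad_cst (v : X -> R) ys (r : R) : 0 <= r -> {in ys, forall y, `|v y| <= r} ->
  rad (fun y _ => v y) ys 0 <= r * Num.sqrt (size ys)%:R.
Proof.
move=> r0 vr.
have norm1 (x : R) : norm2 (const_mx x : 'cV[R]_1) = `|x|.
  by rewrite /norm2 big_ord1 mxE sqrtr_sqr.
have -> : (fun y (_ : T) => v y) =
    (fun y (t : T) => dot (const_mx 1 : 'cV[R]_1) (const_mx (v y))).
  by apply/funext => y; apply/funext => t; rewrite /dot big_ord1 !mxE mul1r.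
by apply: rad_linear => // [t|y yys]; rewrite norm1 ?normr1 ?vr.
Qed.

End Exponential.

(** * Uniform deviations for a finite class on a finite sample space *)

Section Deviation.
Context {R : realType} {T : finType}.
Implicit Types (F : (T -> R) -> R) (a : T -> R).

Local Notation rad := (signavg (@max0 R T)).

Definition wmean (K : finType) (p : K -> R) (f : K -> T -> R) : T -> R :=
  fun t => \sum_k p k * f k t.

(** Convexity of [F], stated for all finite weightings at once: this form is
    visibly stable under translations and under averages over signs and samples,
    and contains both the Jensen inequality for [p] and the midpoint inequality. *)
Definition jensen F := forall (K : finType) (p : K -> R) (v : K -> T -> R),
  (forall k, 0 <= p k) -> \sum_k p k = 1 ->
  F (wmean p v) <= \sum_k p k * F (v k).

Lemma jensen_expR_max0 (lam : R) : 0 <= lam ->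
  jensen (fun a => expR (lam * max0 a)).
Proof.
move=> lam0 K p v p0 p1.
set m := \sum_k p k * (lam * max0 (v k)).
apply: (@le_trans _ _ (expR m)).
  rewrite ler_expR /m; under eq_bigr do rewrite mulrCA.
  rewrite -mulr_sumr ler_wpM2l //; apply: max0_leP => [|t].
    by rewrite sumr_ge0 // => k _; rewrite mulr_ge0 ?max0_ge0.
  by rewrite ler_sum // => k _; rewrite ler_wpM2l ?le_max0.
(* each value lies above the tangent line of the exponential at the mean [m] *)
apply: (@le_trans _ _ (\sum_k p k * (expR m * (1 + (lam * max0 (v k) - m))))).
  rewrite le_eqVlt; apply/orP; left; apply/eqP.
  under eq_bigr do rewrite mulrCA.
  rewrite -mulr_sumr (_ : \sum_k _ = 1) ?mulr1 //.
  rewrite (_ : \sum_k _ = \sum_k p k + (m - (\sum_k p k) * m)); last first.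
    rewrite mulr_suml /m -sumrB -big_split /=; apply: eq_bigr => k _; ring.
  by rewrite p1; ring.
apply: ler_sum => k _; rewrite ler_wpM2l //.
apply: (le_trans (ler_wpM2l (expR_ge0 _) (expR_ge1Dx _))).
by rewrite -expRD addrC subrK.
Qed.

Lemma jensen_translate F b : jensen F -> jensen (fun a => F (a + b)).
Proof.
move=> JF K p v p0 p1.
rewrite (_ : wmean p v + b = wmean p (fun k => v k + b)); first exact: JF.
apply/funext => t; rewrite addfE /wmean -[b t in LHS]mul1r -p1 mulr_suml -big_split /=.
by apply: eq_bigr => k _; rewrite mulrDr.
Qed.

Lemma jensen_signavg F (X : Type) (h : X -> T -> R) (ys : seq X) :
  jensen F -> jensen (signavg F h ys).
Proof.
move=> JF; elim: ys => [//|y ys IH] K p v p0 p1 /=.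
have hD := jensen_translate (h y) IH v p0 p1; have hB := jensen_translate (- h y) IH v p0 p1.
rewrite (_ : \sum_k _ = 2^-1 * (\sum_k p k * signavg F h ys (v k + h y) +
   \sum_k p k * signavg F h ys (v k - h y))); last first.
  by rewrite -big_split mulr_sumr; apply: eq_bigr => k _; rewrite /= mulrCA mulrDr.
by rewrite ler_wpM2l ?invr_ge0 ?ler0n // lerD.
Qed.

Lemma jensen_midpoint F a b : jensen F ->
  F (fun t => 2^-1 * (a t + b t)) <= 2^-1 * (F a + F b).
Proof.
move=> JF; have := JF bool (fun=> 2^-1) (fun i => if i then a else b).
rewrite !big_bool /= -mulrDr.
rewrite (_ : wmean _ _ = fun t => 2^-1 * (a t + b t)); last first.
  by apply/funext => t; rewrite /wmean big_bool /= mulrDr.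
by apply => [_|]; [rewrite invr_ge0 ler0n|field].
Qed.

(** The mean of [Phi] over a sample of [N] independent points of law [p], drawn
    one at a time so that symmetrization can treat one coordinate at a time;
    [iidmean_tuple] is the usual expression as a sum over all samples. *)
Fixpoint iidmean (K : finType) (p : K -> R) (N : nat) (Phi : seq K -> R) : R :=
  if N is N'.+1 then \sum_k p k * iidmean p N' (fun s => Phi (k :: s))
  else Phi [::].

Section Iid.
Context {K : finType} (p : K -> R).
Hypotheses (p0 : forall k, 0 <= p k) (p1 : \sum_k p k = 1).

Lemma iidmean_le N (Phi Psi : seq K -> R) :
  (forall s, size s = N -> Phi s <= Psi s) ->
  iidmean p N Phi <= iidmean p N Psi.
Proof.
elim: N Phi Psi => [|N IH] Phi Psi h /=; first exact: h.
apply: ler_sum => k _; rewrite ler_wpM2l // IH // => s sN.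
by apply: h; rewrite /= sN.
Qed.

Lemma iidmean_cst N c : iidmean p N (fun=> c) = c.
Proof. by elim: N => //= N ->; rewrite -mulr_suml p1 mul1r. Qed.

Lemma iidmeanD N (Phi Psi : seq K -> R) :
  iidmean p N (fun s => Phi s + Psi s) = iidmean p N Phi + iidmean p N Psi.
Proof.
elim: N Phi Psi => //= N IH Phi Psi.
by rewrite -big_split; apply: eq_bigr => k _; rewrite IH mulrDr.
Qed.

Lemma iidmeanZ N (c : R) (Phi : seq K -> R) :
  iidmean p N (fun s => c * Phi s) = c * iidmean p N Phi.
Proof.
elim: N Phi => //= N IH Phi.
by rewrite mulr_sumr; apply: eq_bigr => k _; rewrite IH mulrCA.
Qed.

Lemma iidmean_sum N (I : finType) (Phi : I -> seq K -> R) :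
  iidmean p N (fun s => \sum_i Phi i s) = \sum_i iidmean p N (Phi i).
Proof.
elim: N Phi => //= N IH Phi.
rewrite exchange_big; apply: eq_bigr => k _ /=.
by rewrite IH mulr_sumr.
Qed.

Lemma jensen_iidmean N (F : seq K -> (T -> R) -> R) : (forall s, jensen (F s)) ->
  jensen (fun a => iidmean p N (fun s => F s a)).
Proof.
move=> JF J q v q0 q1.
under eq_bigr do rewrite -iidmeanZ.
by rewrite -iidmean_sum; apply: iidmean_le => s _; exact: JF.
Qed.

Lemma iidmean_tuple N (Phi : seq K -> R) :
  iidmean p N Phi = \sum_(z : N.-tuple K) (\prod_(k <- z) p k) * Phi z.
Proof.
elim: N Phi => [|N IH] Phi /=.
  rewrite (big_pred1 [tuple]) ?big_nil ?mul1r // => z.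
  by rewrite [z]tuple0 /= eqxx.
rewrite (reindex (fun x : K * N.-tuple K => [tuple of x.1 :: x.2])) /=; last first.
  exists (fun z : N.+1.-tuple K => (thead z, [tuple of behead z])) => [[k z]|z] _.
    by congr pair; apply: val_inj.
  by case/tupleP: z => k z; apply: val_inj; rewrite /= theadE.
transitivity (\sum_k \sum_(z : N.-tuple K)
    (\prod_(j <- k :: z) p j) * Phi (k :: z)); last first.
  by rewrite pair_bigA.
apply: eq_bigr => k _; rewrite IH mulr_sumr.
by apply: eq_bigr => z _; rewrite big_cons mulrA.
Qed.

(** Symmetrization.  In one coordinate, [wmean p f] is the mean of an independent
    copy [f k'], so Jensen's inequality replaces [wmean p f - f k] by
    [f k' - f k], which is the midpoint of [2 (f k' - c)] and [- 2 (f k - c)].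
    The constant [c] is free because the deviation is insensitive to it; it will
    be the centre of the range of [f]. *)
Lemma symmetrization F (f : K -> T -> R) (c : R) N a : jensen F ->
  iidmean p N (fun s => F (a + \sum_(k <- s) (wmean p f - f k))) <=
  iidmean p N (fun s => signavg F (fun k t => 2 * (f k t - c)) s a).
Proof.
move=> JF; set h := fun k t => 2 * (f k t - c).
elim: N a => [|N IH] a /=; first by rewrite big_nil addr0.
pose G b := iidmean p N (fun s => signavg F h s b).
have JG : jensen G by apply: jensen_iidmean => s; exact: jensen_signavg.
apply: (@le_trans _ _ (\sum_k p k * G (a + (wmean p f - f k)))).
  apply: ler_sum => k _; rewrite ler_wpM2l // (le_trans _ (IH _)) //.
  by apply: iidmean_le => s _; rewrite big_cons addrA.
have ghost k : G (a + (wmean p f - f k)) <=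
    \sum_k' p k' * (2^-1 * (G (a + h k') + G (a - h k))).
  have -> : a + (wmean p f - f k) = wmean p f + (a - f k) by rewrite addrCA.
  apply: (le_trans (jensen_translate (a - f k) JG f p0 p1)).
  apply: ler_sum => k' _; rewrite ler_wpM2l //.
  apply: le_trans (jensen_midpoint _ _ JG).
  rewrite le_eqVlt; apply/orP; left; apply/eqP; congr G; apply/funext => t.
  by rewrite !addfE !oppfE /h; field.
apply: (@le_trans _ _ (\sum_k p k * (2^-1 * (G (a + h k) + G (a - h k))))); last first.
  apply: ler_sum => k _; rewrite ler_wpM2l //.
  by rewrite iidmeanZ iidmeanD.
apply: (@le_trans _ _ (\sum_k p k * (\sum_k' p k' * (2^-1 * (G (a + h k') + G (a - h k)))))).
  by apply: ler_sum => k _; rewrite ler_wpM2l.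
have -> : \sum_k p k * (\sum_k' p k' * (2^-1 * (G (a + h k') + G (a - h k)))) =
    2^-1 * ((\sum_k p k) * (\sum_k p k * G (a + h k)) +
            (\sum_k p k) * (\sum_k p k * G (a - h k))).
  rewrite [in X in _ = 2^-1 * (_ + X)]mulrC !big_distrl /= -big_split /= mulr_sumr.
  apply: eq_bigr => k _; rewrite -[p k * G _ * _]mulrA [G _ * _]mulrC -mulrDr mulrCA.
  congr (_ * _); rewrite mulr_suml -big_split /= mulr_sumr.
  by apply: eq_bigr => j _; rewrite /=; ring.
rewrite p1 !mul1r -big_split mulr_sumr le_eqVlt; apply/orP; left; apply/eqP.
by apply: eq_bigr => k _; rewrite /=; field.
Qed.

(** Symmetrization at the level of exponential moments, so that the fluctuation
    of the supremum and the Rademacher complexity come out together, followed by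
    Chernoff's bound. *)
Lemma uniform_deviation (f : K -> T -> R) (N : nat) (b rho u : R) :
  (forall k t, 0 <= f k t <= b) -> 0 < b -> 0 <= u ->
  (forall s, size s = N -> rad (fun k t => 2 * (f k t - b / 2)) s 0 <= N%:R * rho) ->
  \sum_(z : N.-tuple K | [exists t, N%:R * (rho + u) < \sum_(k <- z) (wmean p f t - f k t)])
     \prod_(k <- z) p k <= expR (- (N%:R * u ^+ 2 / (2 * b ^+ 2))).
Proof.
move=> fb b0 u0 hrho.
(* the minimizer of [- lam * N u + N * (lam * b)^2 / 2] *)
pose lam := u / b ^+ 2; have lam0 : 0 <= lam by rewrite divr_ge0 ?sqr_ge0.
pose F a := expR (lam * max0 a).
pose beta := N%:R * (rho + u).
pose dev (s : seq K) := \sum_(k <- s) (wmean p f - f k).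
have devE s t : dev s t = \sum_(k <- s) (wmean p f t - f k t) by rewrite /dev fct_sumE.
apply: (@le_trans _ _ (iidmean p N (fun s => expR (- (lam * beta)) * F (0 + dev s)))).
  rewrite iidmean_tuple big_mkcond /=; apply: ler_sum => z _.
  have pz0 : 0 <= \prod_(k <- z) p k by rewrite prodr_ge0.
  case: ifPn => [/existsP[t zt]|_]; last by rewrite !mulr_ge0 ?expR_ge0.
  rewrite -[leLHS]mulr1 ler_wpM2l // /F -expRD -[leLHS]expR0 ler_expR add0r.
  rewrite addrC -mulrBr mulr_ge0 // subr_ge0 ltW // (lt_le_trans zt) //.
  by rewrite -devE le_max0.
rewrite iidmeanZ.
have JF : jensen F by exact: jensen_expR_max0.
apply: (@le_trans _ _ (expR (- (lam * beta)) *
   expR (lam * (N%:R * rho) + N%:R * (lam * b) ^+ 2 / 2))).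
  rewrite ler_wpM2l ?expR_ge0 //.
  apply: (le_trans (symmetrization f (b / 2) N 0 JF)).
  rewrite -[leRHS](iidmean_cst N); apply: iidmean_le => s sN.
  apply: (le_trans (@signavg_expR_le _ _ _ _ _ _ _ b lam0 _)) => [k _ t|].
    by rewrite ler_norml; have := fb k t => /andP[? ?]; apply/andP; split; lra.
  by rewrite ler_expR sN lerD2r ler_wpM2l // hrho.
rewrite -expRD ler_expR le_eqVlt; apply/orP; left; apply/eqP.
by rewrite /beta /lam; field; rewrite gt_eqF.
Qed.

End Iid.
End Deviation.

(** * The loss of two-layer networks *)

Section Network.
Context {R : realType} {n : nat}.
Implicit Types (P B : 'M[R]_n) (theta : theta_param R n) (x y : 'cV[R]_n).

Definition sqloss P B theta y : R := norm2 (P *m (network theta y - B *m y)) ^+ 2.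

Lemma relu_lipschitz (x y : R) : `|Num.max x 0 - Num.max y 0| <= `|x - y|.
Proof.
have hx := ler_norm (x - y); have hy := ler_norm (y - x); rewrite distrC in hy.
by rewrite ler_norml; apply/andP; split; case: (leP x 0) => ?; case: (leP y 0) => ?; lra.
Qed.

Lemma norm_relu_le (x : R) : `|Num.max x 0| <= `|x|.
Proof. by have := relu_lipschitz x 0; rewrite maxxx !subr0. Qed.

Lemma norm2_reluB x y : norm2 (relu x - relu y) <= norm2 (x - y).
Proof. by apply: le_norm2 => i; rewrite !mxE relu_lipschitz. Qed.

Section Bounds.
Context {P B : 'M[R]_n} {C : R}.
Hypotheses (BC : spectral_norm B <= C).

Lemma bound_ge0 : 0 <= C.
Proof. exact: le_trans (spectral_norm_ge0 B) BC. Qed.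

Lemma norm2_weight theta (j : 'I_2) x : theta_set R n C theta ->
  norm2 (weight theta j *m x) <= norm2 x.
Proof.
move=> /(_ j)[_ W1]; apply: (le_trans (norm2_mulmx _ _)).
by rewrite ler_piMl ?norm2_ge0.
Qed.

Lemma norm2_errorB theta x y : theta_set R n C theta ->
  norm2 (network theta x - B *m x - (network theta y - B *m y)) <=
  3 * C * norm2 (x - y).
Proof.
move=> th; have -> : network theta x - B *m x - (network theta y - B *m y) =
    (network theta x - network theta y) - B *m (x - y).
  by rewrite mulmxBr !opprD !opprK addrACA.
apply: (le_trans (norm2B _ _)).
have -> : network theta x - network theta y =
    \sum_(j < 2) coef theta j *: (relu (weight theta j *m x) - relu (weight theta j *m y)).
  by rewrite /network -sumrB; apply: eq_bigr => j _; rewrite scalerBr.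
have : norm2 (B *m (x - y)) <= C * norm2 (x - y).
  by rewrite (le_trans (norm2_mulmx _ _)) // ler_wpM2r ?norm2_ge0.
have : norm2 (\sum_(j < 2) coef theta j *: (relu (weight theta j *m x)
    - relu (weight theta j *m y))) <= \sum_(j < 2) C * norm2 (x - y).
  apply: (le_trans (norm2_sum _)); apply: ler_sum => j _.
  rewrite norm2Z ler_pM ?norm2_ge0 //; first by have [] := th j.
  rewrite (le_trans (norm2_reluB _ _)) // -mulmxBr; exact: norm2_weight.
by rewrite big_const_ord /= addr0 => *; lra.
Qed.

Lemma norm2_error theta x : theta_set R n C theta ->
  norm2 (network theta x - B *m x) <= 3 * C * norm2 x.
Proof.
move=> th; have := norm2_errorB x 0 th.
have -> : network theta 0 - B *m 0 = 0.
  rewrite /network mulmx0 subr0 big1 // => j _.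
  rewrite mulmx0 (_ : relu 0 = 0) ?scaler0 //.
  by apply/matrixP => i k; rewrite !mxE maxxx.
by rewrite !subr0.
Qed.

Lemma sqloss_bound theta y : theta_set R n C theta -> norm2 y = 1 ->
  0 <= sqloss P B theta y <= 9 * C ^+ 2 * spectral_norm P ^+ 2.
Proof.
move=> th y1; rewrite sqr_ge0 /=.
rewrite (_ : 9 * C ^+ 2 * _ = (spectral_norm P * (3 * C)) ^+ 2); last by ring.
rewrite lerXn2r ?nnegrE ?norm2_ge0 ?mulr_ge0 ?spectral_norm_ge0 ?bound_ge0 //.
apply: (le_trans (norm2_mulmx _ _)); rewrite ler_wpM2l ?spectral_norm_ge0 //.
by rewrite (le_trans (norm2_error _ th)) // y1 mulr1.
Qed.

Lemma sqloss_lipschitz theta x y :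
  theta_set R n C theta -> norm2 x = 1 -> norm2 y = 1 ->
  sqloss P B theta x <=
  sqloss P B theta y + 18 * C ^+ 2 * spectral_norm P ^+ 2 * norm2 (x - y).
Proof.
move=> th x1 y1; rewrite /sqloss.
have S0 := spectral_norm_ge0 P; have C0 := bound_ge0.
set u := P *m _; set v := P *m (_ - B *m y).
have bd z : norm2 z = 1 ->
    norm2 (P *m (network theta z - B *m z)) <= spectral_norm P * (3 * C).
  move=> z1; apply: (le_trans (norm2_mulmx _ _)); rewrite ler_wpM2l //.
  by rewrite (le_trans (norm2_error _ th)) // z1 mulr1.
have uv : norm2 (u - v) <= spectral_norm P * (3 * C * norm2 (x - y)).
  rewrite /u /v -mulmxBr (le_trans (norm2_mulmx _ _)) // ler_wpM2l //.
  exact: norm2_errorB.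
have uB := bd x x1; have vB := bd y y1; rewrite -/u in uB; rewrite -/v in vB.
have nu : norm2 u <= norm2 v + norm2 (u - v).
  by rewrite -{1}(subrK v u) addrC norm2D.
have : (norm2 u - norm2 v) * (norm2 u + norm2 v) <=
    norm2 (u - v) * (norm2 u + norm2 v).
  by rewrite ler_wpM2r ?addr_ge0 ?norm2_ge0 //; lra.
have : norm2 (u - v) * (norm2 u + norm2 v) <=
    spectral_norm P * (3 * C * norm2 (x - y)) * (2 * (spectral_norm P * (3 * C))).
  by rewrite ler_pM ?addr_ge0 ?norm2_ge0 //; lra.
rewrite (_ : spectral_norm P * _ * _ =
  18 * C ^+ 2 * spectral_norm P ^+ 2 * norm2 (x - y)); last by ring.
by rewrite -subr_sqr => *; lra.
Qed.

(** The identity [z = max z 0 - max (- z) 0] makes the target itself a network. *)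
Lemma network_exact : exists2 theta, theta_set R n C theta &
  forall x, network theta x = B *m x.
Proof.
have C0 := bound_ge0.
pose sg (j : 'I_2) : R := if j == 0 then 1 else -1.
exists (ThetaParam (fun j => sg j * C) (fun j => (sg j * C^-1) *: B)) => [j|x] /=.
  have sg1 : `|sg j| = 1 by rewrite /sg; case: ifP; rewrite ?normrN1 ?normr1.
  rewrite normrM sg1 mul1r ger0_norm //; split=> //.
  apply: spectral_norm_le => // v; rewrite mul1r -scalemxAl norm2Z normrM sg1 mul1r.
  rewrite ger0_norm ?invr_ge0 //; have := norm2_mulmx B v.
  have [->|Cn0] := eqVneq C 0; first by rewrite invr0 mul0r norm2_ge0.
  have Cgt0 : 0 < C by rewrite lt_neqAle eq_sym Cn0.
  move=> Bv; rewrite mulrC ler_pdivrMr // mulrC (le_trans Bv) //.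
  by rewrite ler_wpM2r ?norm2_ge0.
rewrite /network big_ord_recl big_ord1 /= /sg /= !mul1r !mulN1r.
have [C_eq0|Cn0] := eqVneq C 0.
  rewrite C_eq0 oppr0 !scale0r addr0; apply/esym/norm2_eq0/eqP.
  rewrite eq_le norm2_ge0 andbT (le_trans (norm2_mulmx _ _)) //.
  by rewrite mulr_le0_ge0 ?norm2_ge0 // -C_eq0.
have CK (z : R) : C * (C^-1 * z) = z by rewrite mulrA mulfV // mul1r.
rewrite -!scalemxAl; apply/matrixP => i k; rewrite !mxE.
set z := \sum_j _; rewrite -{3}(CK z) !mulNr; move: (C^-1 * z) => w.
rewrite -mulrBr; congr (_ * _).
by case: (leP w 0) => ?; case: (leP (- w) 0) => ?; lra.
Qed.

End Bounds.

Section Complexity.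
Context {P B : 'M[R]_n} {C : R} {T : finType} (th : T -> theta_param R n).
Hypotheses (BC : spectral_norm B <= C) (thC : forall t, theta_set R n C (th t)).

Local Notation rad := (signavg (@max0 R T)).

Variable ys : seq 'cV[R]_n.
Hypothesis ys1 : {in ys, forall y, norm2 y = 1}.

Let rN : R := Num.sqrt (size ys)%:R.
Let rN0 : 0 <= rN. Proof. exact: sqrtr_ge0. Qed.
Let C0 : 0 <= C. Proof. exact: bound_ge0 BC. Qed.

Let err k : 'cV[R]_n -> T -> R :=
  fun y t => (P *m (network (th t) y - B *m y)) k 0.

(** A single neuron is a contraction of a linear functional of norm at most one. *)
Lemma rad_neuron j l :
  rad (fun y t => Num.max ((weight (th t) j *m y) l 0) 0) ys 0 <= rN /\
  rad (- (fun y t => Num.max ((weight (th t) j *m y) l 0) 0)) ys 0 <= rN.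
Proof.
pose lin y t := dot (rowv (weight (th t) j) l) y.
have linE y t : (weight (th t) j *m y) l 0 = lin y t by rewrite mulmx_rowv.
have radlin : rad lin ys 0 <= rN.
  rewrite -[leRHS]mul1r; apply: (rad_linear (v := id)) => //= [t|y /ys1 -> //].
  by apply: (le_trans (rowv_le_spectral _ _)); have [] := thC t j.
split; apply: (le_trans _ radlin); apply: rad_contraction => y _ t.
- by rewrite linE norm_relu_le.
- by move=> s; rewrite !linE relu_lipschitz.
- by rewrite !oppfE linE normrN norm_relu_le.
- by move=> s; rewrite !oppfE !linE -opprD normrN relu_lipschitz.
Qed.

(** Each of the [2 n] neurons costs its coefficient bound twice, once for each
    sign, and the linear target costs one more unit: [4 n + 1 <= 5 n]. *)
Lemma rad_error k : rad (err k) ys 0 <= 5 * n%:R * C * norm2 (rowv P k) * rN.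
Proof.
pose neuron j l y t : R := Num.max ((weight (th t) j *m y) l 0) 0.
have coordP l : `|P k l| <= norm2 (rowv P k).
  by have := coord_le_norm2 (rowv P k) l; rewrite !mxE.
have errE : err k = (\sum_(j < 2) \sum_(l < n)
       fun y t => (coef (th t) j * P k l) * neuron j l y t)
     + (fun y _ => - (P *m (B *m y)) k 0).
  apply/funext => y; apply/funext => t; rewrite addfE addfE /err.
  rewrite mulmxBr mxE [X in _ + X]mxE; congr (_ - _).
  rewrite !fct_sumE /network mulmx_sumr summxE; apply: eq_bigr => j _.
  rewrite !fct_sumE -scalemxAr mxE [X in _ * X]mxE mulr_sumr; apply: eq_bigr => l _.
  by rewrite /neuron /relu mxE mulrA.
rewrite errE -[X in rad _ _ X](addr0 0); apply: (le_trans (radD _ _ _ _ _)).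
have part2 : rad (fun y _ => - (P *m (B *m y)) k 0) ys 0 <= norm2 (rowv P k) * C * rN.
  apply: rad_cst => [|y /ys1 y1]; first by rewrite mulr_ge0 ?norm2_ge0.
  rewrite normrN mulmx_rowv (le_trans (dot_le _ _)) // ler_wpM2l ?norm2_ge0 //.
  by rewrite (le_trans (norm2_mulmx _ _)) // y1 mulr1.
have part1 : rad (\sum_(j < 2) \sum_(l < n)
       fun y t => (coef (th t) j * P k l) * neuron j l y t)
    ys 0 <= \sum_(j < 2) \sum_(l < n) C * norm2 (rowv P k) * (rN + rN).
  apply: rad_sum => j; apply: rad_sum => l; have [h1 h2] := rad_neuron j l.
  have cC t : `|coef (th t) j * P k l| <= C * norm2 (rowv P k).
    by rewrite normrM ler_pM //; have [] := thC t j.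
  have := rad_scale (neuron j l) ys 0 cC.
  rewrite (_ : (fun t => _ * 0 t) = 0); last by apply/funext => t; rewrite mulr0.
  move=> /le_trans; apply.
  by rewrite oppr0 ler_wpM2l ?mulr_ge0 ?norm2_ge0 // lerD.
move: part1; rewrite !big_const_ord /= !iter_addr_0 /= addr0 -mulr_natl => part1.
have n1 : 1 <= n%:R :> R by rewrite ler1n (leq_ltn_trans (leq0n k)).
have : norm2 (rowv P k) * C * rN <= n%:R * (norm2 (rowv P k) * C * rN).
  by rewrite ler_peMl // !mulr_ge0 ?norm2_ge0.
by move: part1 part2; set z := norm2 _ => *; nra.
Qed.

(** The loss is the sum over the coordinates of the squared errors, and each
    square is contracted at its Lipschitz constant: [30 = 6 * 5]. *)
Lemma rad_sqloss : rad (fun y t => sqloss P B (th t) y) ys 0 <=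
  30 * n%:R * C ^+ 2 * frobenius_norm P ^+ 2 * rN.
Proof.
rewrite (_ : (fun y t => _) = \sum_k (fun y t => err k y t ^+ 2)); last first.
  apply/funext => y; apply/funext => t; rewrite /sqloss sqr_norm2 !fct_sumE.
  by apply: eq_bigr => k _.
rewrite (_ : 30 * _ * _ * _ * _ =
    \sum_k 30 * n%:R * C ^+ 2 * norm2 (rowv P k) ^+ 2 * rN); last first.
  by rewrite sqr_frobenius mulr_sumr mulr_suml.
apply: rad_sum => k; set z := norm2 (rowv P k).
have z0 : 0 <= z by exact: norm2_ge0.
have errB y t : y \in ys -> `|err k y t| <= 3 * C * z.
  move=> /ys1 y1; rewrite /err mulmx_rowv (le_trans (dot_le _ _)) //.
  rewrite mulrC ler_wpM2r // (le_trans (norm2_error BC _ (thC t))) //.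
  by rewrite y1 mulr1.
(* on the range of [err k] the square is Lipschitz with constant [6 * C * z] *)
have c0 : 0 <= 6 * C * z by rewrite !mulr_ge0.
apply: (@le_trans _ _ (rad (fun y t => (6 * C * z) * err k y t) ys 0)).
  apply: rad_contraction => y yys t => [|s].
    rewrite expr2 normrM (normrM (6 * C * z)) (ger0_norm c0) ler_wpM2r //.
    rewrite (le_trans (errB _ _ yys)) //; have : 0 <= C * z by rewrite mulr_ge0.
    by move=> ?; lra.
  rewrite -mulrBr subr_sqr mulrC normrM (normrM (6 * C * z)) (ger0_norm c0) ler_wpM2r //.
  rewrite (le_trans (ler_normD _ _)) //.
  by have := errB y t yys; have := errB y s yys; lra.
have := radZ (err k) ys 0 c0.
rewrite (_ : (fun t => _ * 0 t) = 0); last by apply/funext => t; rewrite mulr0.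
move=> /le_trans; apply; apply: (le_trans (ler_wpM2l c0 (rad_error k))).
by rewrite le_eqVlt; apply/orP; left; apply/eqP; rewrite -/z; ring.
Qed.

(** Centring the loss at the middle of its range, as the exponential bound
    requires, adds only the mean of a signed sum of constants:
    [69 = 2 * 30 + 9]. *)
Lemma rad_centred_sqloss : (0 < n)%N ->
  rad (fun y t => 2 * (sqloss P B (th t) y - 9 * C ^+ 2 * spectral_norm P ^+ 2 / 2)) ys 0 <=
  69 * n%:R * C ^+ 2 * frobenius_norm P ^+ 2 * rN.
Proof.
move=> n0; set b := 9 * C ^+ 2 * spectral_norm P ^+ 2.
rewrite (_ : (fun y t => _) = (fun y t => 2 * sqloss P B (th t) y) + (fun y _ => - b)); last first.
  by apply/funext => y; apply/funext => t; rewrite !addfE; field.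
rewrite -[X in rad _ _ X](addr0 0); apply: (le_trans (radD _ _ _ _ _)).
have b0 : 0 <= b by rewrite !mulr_ge0 // spectral_norm_ge0.
have part2 : rad (fun y _ => - b) ys 0 <= b * rN.
  by apply: rad_cst => // y _; rewrite normrN ger0_norm.
have := radZ (fun y t => sqloss P B (th t) y) ys 0 (ler0n R 2).
rewrite (_ : (fun t => _ * 0 t) = 0); last by apply/funext => t; rewrite mulr0.
have := rad_sqloss => part1 part1'.
have SF : spectral_norm P ^+ 2 <= frobenius_norm P ^+ 2.
  by rewrite lerXn2r ?nnegrE ?spectral_norm_ge0 ?sqrtr_ge0 ?spectral_le_frobenius.
have bF : b <= 9 * n%:R * C ^+ 2 * frobenius_norm P ^+ 2.
  have CSF := ler_wpM2l (sqr_ge0 C) SF.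
  have CF0 : 0 <= C ^+ 2 * frobenius_norm P ^+ 2 by rewrite mulr_ge0 ?sqr_ge0.
  have : C ^+ 2 * frobenius_norm P ^+ 2 <= n%:R * (C ^+ 2 * frobenius_norm P ^+ 2).
    by rewrite ler_peMl // ler1n.
  by rewrite /b => *; lra.
have := ler_wpM2r rN0 bF => bFr.
apply: (le_trans (lerD part1' part2)); lra.
Qed.

End Complexity.
End Network.

(** * Generalisation on a finite sample space *)

Section Discrete.
Context {R : realType} {n : nat} {K : finType} (p : K -> R) (rep : K -> 'cV[R]_n).
Hypotheses (p0 : forall k, 0 <= p k) (p1 : \sum_k p k = 1).
Hypothesis rep1 : forall k, norm2 (rep k) = 1.

(** The supremum over the infinite parameter set needs no net: it suffices to
    control, for every sample that violates the bound, one parameter that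
    witnesses the violation, and there are only finitely many samples. *)
Lemma discrete_generalization (P B : 'M[R]_n) (C eps : R) (N : nat) :
  (0 < N)%N -> (0 < n)%N -> spectral_norm B <= C -> 0 < C -> 0 < spectral_norm P ->
  0 < eps < 1 ->
  exists good : pred (N.-tuple K),
    1 - eps <= \sum_(z | good z) \prod_(k <- z) p k /\
    forall z, good z -> forall theta, theta_set R n C theta ->
      \sum_k p k * sqloss P B theta (rep k) <=
      N%:R^-1 * (\sum_(k <- z) sqloss P B theta (rep k)) +
      (69 * n%:R * C ^+ 2 * frobenius_norm P ^+ 2 / Num.sqrt N%:R
       + 9 * C ^+ 2 * spectral_norm P ^+ 2 * Num.sqrt (2 * ln (2 / eps) / N%:R)).
Proof.
move=> N0 n0 BC C0 P0 /andP[eps0 eps1].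
set rho := 69 * _ * _ * _ / _; set b := 9 * C ^+ 2 * _; set u := b * _.
have NR0 : 0 < N%:R :> R by rewrite ltr0n.
have b0 : 0 < b by rewrite !mulr_gt0 ?exprn_gt0.
have u0 : 0 <= u by rewrite mulr_ge0 ?sqrtr_ge0 // ltW.
pose mean theta := \sum_k p k * sqloss P B theta (rep k).
pose violates (z : N.-tuple K) theta := theta_set R n C theta /\
  N%:R * (rho + u) < \sum_(k <- z) (mean theta - sqloss P B theta (rep k)).
pose bad (z : N.-tuple K) := `[< exists theta, violates z theta >].
have [theta0 th0 _] := network_exact BC.
have /choice[th thP] (z : N.-tuple K) : exists theta,
    theta_set R n C theta /\ (bad z -> violates z theta).
  have [/asboolP[theta V]|nbz] := boolP (bad z).
    by exists theta; split => //; have [] := V.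
  by exists theta0.
have thC z : theta_set R n C (th z) by have [] := thP z.
have thV z : bad z -> violates z (th z) by have [] := thP z.
pose f (k : K) (z : N.-tuple K) := sqloss P B (th z) (rep k).
have total : \sum_(z : N.-tuple K) \prod_(k <- z) p k = 1.
  rewrite -[RHS](iidmean_cst p1 N 1) iidmean_tuple.
  by apply: eq_bigr => z _; rewrite mulr1.
have prod0 (z : N.-tuple K) : 0 <= \prod_(k <- z) p k by rewrite prodr_ge0.
exists (predC bad); split; last first.
  move=> z /= nbz theta thCt; rewrite -lerBlDl leNgt; apply: contra nbz => viol.
  apply/asboolP; exists theta; split => //.
  rewrite sumrB big_const_seq count_predT iter_addr_0 size_tuple -(mulr_natl (mean theta)).
  rewrite -ltr_pdivlMl // mulrBr mulrA mulVf ?gt_eqF // mul1r.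
  exact: viol.
suff : \sum_(z | bad z) \prod_(k <- z) p k <= eps.
  by move: total; rewrite (bigID bad) /= => *; lra.
have hrho s : size s = N ->
    signavg (@max0 R _) (fun k t => 2 * (f k t - b / 2)) s 0 <= N%:R * rho.
  move=> sN.
  have rs1 : {in map rep s, forall y, norm2 y = 1} by move=> _ /mapP[k _ ->].
  have := rad_centred_sqloss (P := P) BC thC rs1 n0.
  rewrite signavg_map size_map sN => /le_trans; apply.
  rewrite le_eqVlt; apply/orP; left; apply/eqP; rewrite /rho.
  have sqN : Num.sqrt N%:R != 0 :> R by rewrite gt_eqF // sqrtr_gt0.
  rewrite -{2}[N%:R](sqr_sqrtr (ltW NR0)); field.
  exact: sqN.
have fb k t : 0 <= f k t <= b by exact: sqloss_bound.
have dev := uniform_deviation p0 p1 fb b0 u0 hrho.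
apply: (@le_trans _ _ (expR (- ln (2 / eps)))); last first.
  rewrite expRN lnK ?posrE ?divr_gt0 // invf_div; lra.
have -> : ln (2 / eps) = N%:R * u ^+ 2 / (2 * b ^+ 2).
  have ln0 : 0 <= ln (2 / eps) by rewrite ln_ge0 // ler_pdivlMr // mul1r; lra.
  have arg0 : 0 <= 2 * ln (2 / eps) / N%:R by rewrite divr_ge0 ?ler0n // mulr_ge0.
  by rewrite /u (exprMn _ b) sqr_sqrtr //; field; rewrite !gt_eqF.
apply: le_trans dev; rewrite [leLHS]big_mkcond [leRHS]big_mkcond /=.
apply: ler_sum => z _; case: ifPn => [bz|_]; last by case: ifP.
rewrite ifT //; apply/existsP; exists z; have [_] := thV z bz.
exact.
Qed.

End Discrete.

(** * Discretisation of the sphere and of the sample *)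

Section FinitePartition.
Context {R : realType} {d : measure_display} {T : measurableType d}.
Context (mu : {measure set T -> \bar R}) {K : finType}.

Lemma measure_finite_bigcup (D : pred K) (F : K -> set T) :
  (forall k, measurable (F k)) -> trivIset setT F ->
  mu (\bigcup_(k in [set k | D k]) F k) = (\sum_(k | D k) mu (F k))%E.
Proof.
move=> mF tF; rewrite measure_fin_bigcup //; last 2 first.
- exact: finite_finset.
- exact: sub_trivIset tF.
rewrite (_ : [set k | D k] = [set` enum D]); last first.
  by apply/seteqP; split => k /=; rewrite mem_enum.
by rewrite -fsbig_seq ?enum_uniq // big_enum.
Qed.

Lemma integral_le_partition (F : K -> set T) (g : T -> R) (c : K -> R) (D : set T) :
  measurable D -> mu (~` D) = 0%E -> D = \bigcup_k F k ->
  (forall k, measurable (F k)) -> trivIset setT F ->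
  measurable_fun setT g -> (forall x, 0 <= g x) ->
  (forall k x, F k x -> g x <= c k) ->
  (\int[mu]_x (g x)%:E <= \sum_k (c k)%:E * mu (F k))%E.
Proof.
move=> mD D0 DF mF tF mg g0 gc.
have mgE (A : set T) : measurable_fun A (EFin \o g).
  by apply/measurable_EFinP; exact: (measurable_funS measurableT).
have gE0 (A : set T) x : A x -> (0 <= (g x)%:E)%E by rewrite lee_fin.
rewrite (ge0_negligible_integral (measurableC mD) measurableT (mgE _) (gE0 _) D0).
rewrite setTD setCK DF (_ : \bigcup_k F k = \big[setU/set0]_(k <- enum K) F k); last first.
  rewrite -bigcup_seq; congr (\bigcup_(k in _) _).
  by apply/seteqP; split => k //= _; rewrite mem_enum.
rewrite ge0_integral_bigsetU ?enum_uniq //; last 2 first.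
- exact: sub_trivIset tF.
- exact: gE0.
rewrite big_enum /=; apply: lee_sum => k _.
rewrite -integral_cst //; apply: ge0_le_integral => //.
- exact: gE0.
- by move=> x Fx; rewrite lee_fin gc.
Qed.

End FinitePartition.

(** Mutual independence, used for the whole index set. *)
Lemma iid_sample_rectangle (R : realType) (d d' : measure_display)
    (Omega : measurableType d) (T : measurableType d') (Pr : probability Omega R)
    (mu : probability T R) (N : nat) (X : 'I_N -> {RV Pr >-> T}) (B : 'I_N -> set T) :
  iid_sample mu X -> (forall i, measurable (B i)) ->
  Pr (\bigcap_i (X i @^-1` B i)) = (\prod_(i < N) mu (B i))%E.
Proof.
move=> [indep law] mB.
have -> : \bigcap_i (X i @^-1` B i) = \bigcap_(i in [set` [set: 'I_N]%SET]) (X i @^-1` B i).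
  by congr (\bigcap_(i in _) _); apply/seteqP; split => i //= _; rewrite inE.
rewrite indep //; apply: eq_big => [i|i _]; first by rewrite inE.
by rewrite -(law i).
Qed.

Section Sphere.
Context {R : realType} {n : nat}.
Local Notation Rn := (borelRn R n).

Lemma measurable_coord (i : 'I_n) : measurable_fun setT (fun y : Rn => (y : 'cV[R]_n) i 0).
Proof.
apply: (measurability _ (RGenOpens.measurableE R)).
move=> _ [_ [a [b ->] <-]]; rewrite setTI; apply: sub_sigma_algebra.
apply: open_comp; last exact: interval_open.
by move=> y _; exact: coord_continuous.
Qed.

Lemma measurable_mulmx m (B : 'M[R]_(m, n)) (l : 'I_m) :
  measurable_fun setT (fun y : Rn => (B *m (y : 'cV[R]_n)) l 0).
Proof.
under eq_fun do rewrite mxE.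
apply: measurable_sum => j; apply: measurable_funM; first exact: measurable_cst.
exact: measurable_coord.
Qed.

Lemma measurable_network_error (B : 'M[R]_n) (theta : theta_param R n) (l : 'I_n) :
  measurable_fun setT (fun y : Rn => (network theta y - B *m (y : 'cV[R]_n)) l 0).
Proof.
under eq_fun do rewrite mxE [X in _ + X]mxE.
apply: measurable_funB; last exact: measurable_mulmx.
under eq_fun do rewrite summxE; apply: measurable_sum => j.
under eq_fun do rewrite mxE [X in _ * X]mxE.
apply: measurable_funM; first exact: measurable_cst.
by apply: measurable_maxr; [exact: measurable_mulmx|exact: measurable_cst].
Qed.

Lemma measurable_sqnorm_error (A B : 'M[R]_n) (theta : theta_param R n) :
  measurable_fun setT (fun y : Rn => sqnorm_mx A (network theta y - B *m (y : 'cV[R]_n))).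
Proof.
rewrite /sqnorm_mx; under eq_fun do rewrite mxE.
apply: measurable_sum => j; apply: measurable_funM; last exact: measurable_network_error.
under eq_fun do rewrite mxE; apply: measurable_sum => k.
apply: measurable_funM; last exact: measurable_cst.
by under eq_fun do rewrite mxE; exact: measurable_network_error.
Qed.

Lemma measurable_sphere : measurable (unit_sphere R n : set Rn).
Proof.
pose s (y : Rn) : R := \sum_(i < n) (y : 'cV[R]_n) i 0 ^+ 2.
have ms : measurable_fun setT s.
  by apply: measurable_sum => i; apply: measurable_funX; exact: measurable_coord.
rewrite (_ : unit_sphere R n = setT `&` s @^-1` [set 1]); first exact: ms.
rewrite setTI; apply/seteqP; split => y; rewrite /unit_sphere /s /= -sqr_norm2.
  by move=> ->; rewrite expr1n.
by move/eqP; rewrite sqrp_eq1 ?norm2_ge0 // => /eqP.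
Qed.

(** Coordinates of the cell containing [y] in the half-open grid of step [N^-1]
    on the cube [-1, 1]^n; the step is chosen so that the discretisation error is
    at most of the order [(Num.sqrt N)^-1] of the bound. *)
Definition gridindex (N : nat) (y : 'cV[R]_n) : {ffun 'I_n -> 'I_(2 * N).+1} :=
  [ffun i => inord (Num.truncn (N%:R * (y i 0 + 1)))].

Definition gridcell (N : nat) (k : {ffun 'I_n -> 'I_(2 * N).+1}) : set Rn :=
  unit_sphere R n `&` [set y | gridindex N y = k].

Lemma gridindexP N (y : 'cV[R]_n) i : norm2 y = 1 ->
  (gridindex N y i)%:R <= N%:R * (y i 0 + 1) < (gridindex N y i).+1%:R.
Proof.
move=> y1; have := coord_le_norm2 y i; rewrite y1 ler_norml => /andP[ym yM].
have z0 : 0 <= N%:R * (y i 0 + 1) by rewrite mulr_ge0 //; lra.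
rewrite ffunE inordK ?truncn_itv // ltnS truncn_le_nat.
have : N%:R * (y i 0 + 1) <= N%:R * 2 by rewrite ler_wpM2l //; lra.
by rewrite -(natr1 (2 * N)%N) natrM mulrC => *; lra.
Qed.

Lemma gridindex_eq N (y : 'cV[R]_n) (k : {ffun 'I_n -> 'I_(2 * N).+1}) :
  (forall i, (k i)%:R <= N%:R * (y i 0 + 1) < (k i).+1%:R) -> gridindex N y = k.
Proof. by move=> yk; apply/ffunP => i; rewrite ffunE (truncn_def (yk i)) inord_val. Qed.

Lemma measurable_gridcell N k : measurable (@gridcell N k).
Proof.
rewrite (_ : gridcell k = unit_sphere R n `&` \bigcap_(i in [set: 'I_n])
   (setT `&` (fun y : Rn => N%:R * ((y : 'cV[R]_n) i 0 + 1)) @^-1`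
       `[(k i)%:R, (k i).+1%:R[%classic)); last first.
  apply/seteqP; split => y [y1 yk]; split => //.
    by move=> i _; split => //=; rewrite in_itv /= -yk; exact: gridindexP.
  by apply: gridindex_eq => i; have [_] := yk i Logic.I; rewrite /= in_itv.
apply: measurableI; first exact: measurable_sphere.
apply: fin_bigcap_measurable => [|i _]; first exact: finite_finset.
have : measurable_fun setT (fun y : Rn => N%:R * ((y : 'cV[R]_n) i 0 + 1)).
  apply: measurable_funM; first exact: measurable_cst.
  by apply: measurable_funD; [exact: measurable_coord|exact: measurable_cst].
by apply => //; exact: measurable_itv.
Qed.

Lemma trivIset_gridcell N : trivIset setT (@gridcell N).
Proof. by move=> k l _ _ [y [[_ <-] [_ <-]]]. Qed.

Lemma bigcup_gridcell N : \bigcup_k @gridcell N k = (unit_sphere R n : set Rn).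
Proof.
apply/seteqP; split => [y [k _ []] //|y y1].
by exists (gridindex N y).
Qed.

Lemma gridcell_diameter N k (x y : 'cV[R]_n) : (0 < N)%N ->
  @gridcell N k x -> gridcell k y -> norm2 (x - y) <= n%:R / N%:R.
Proof.
move=> N0 [x1 xk] [y1 yk]; apply: norm2_le_coord => i; rewrite !mxE.
have := gridindexP N i x1; have := gridindexP N i y1.
rewrite [gridindex N x]xk [gridindex N y]yk -(natr1 (k i)).
set z := (k i)%:R => /andP[a1 a2] /andP[b1 b2].
have NR0 : 0 < N%:R :> R by rewrite ltr0n.
rewrite -(ler_pM2l NR0) mulfV ?gt_eqF // -{1}(ger0_norm (ltW NR0)) -normrM ler_norml.
by apply/andP; split; lra.
Qed.

End Sphere.

(** * The generalisation bound *)

(** By convention [invmx A] is [A] itself when [A] is not invertible, so that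
    positivity excludes a kernel in either case. *)
Lemma spdmx_invmx_neq0 (R : realType) (n : nat) (A : 'M[R]_n) (v : 'cV[R]_n) :
  spdmx A -> v != 0 -> invmx A *m v != 0.
Proof.
move=> [_ Apos] v0; apply: contraTneq (Apos v v0) => Av0.
have [Au|Anu] := boolP (A \in unitmx).
  have vE : v = A *m (invmx A *m v) by rewrite mulmxA mulmxV // mul1mx.
  by move: v0; rewrite vE Av0 mulmx0 eqxx.
move: Av0; rewrite /invmx (negbTE Anu) => Av0.
by rewrite -mulmxA Av0 mulmx0 mxE ltxx.
Qed.

(** The network that equals the target everywhere shows that the infimum of the
    empirical loss is at most [0]. *)
Lemma delta_minimizer_loss (R : realType) (n N : nat) (P B : 'M[R]_n) (C delta : R)
    (ys : 'I_N -> 'cV[R]_n) (theta : theta_param R n) :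
  spectral_norm B <= C ->
  delta_minimizer (theta_set R n C) (empirical_loss P (fun i => B *m ys i) ys) delta theta ->
  N%:R^-1 * (\sum_(i < N) sqloss P B theta (ys i)) <= delta.
Proof.
move=> BC [_]; move/le_trans; apply; rewrite gerDl.
have [theta0 th0 th0E] := network_exact BC.
apply: (@le_trans _ _ (empirical_loss P (fun i => B *m ys i) ys theta0)); last first.
  rewrite /empirical_loss big1 ?mulr0 // => i _.
  by rewrite th0E subrr mulmx0 norm20 expr0n.
apply: ge_inf; last by exists theta0.
exists 0 => _ [t _ <-]; rewrite mulr_ge0 ?invr_ge0 // sumr_ge0 // => i _.
exact: sqr_ge0.
Qed.

Theorem theorem4p2 (R : realType) (n N : nat) (hN : (0 < N)%N)
    (A P : 'M[R]_n) (hA : spdmx A)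
    (hPsym : P \is symmetricmx) (hPinv : P \in unitmx)
    (mu : probability (borelRn R n) R) (hmu : mu (unit_sphere R n) = 1%E)
    (d : measure_display) (Omega : measurableType d)
    (Pr : probability Omega R)
    (y : 'I_N -> {RV Pr >-> borelRn R n}) (hy : iid_sample mu y)
    (C delta eps : R) (hC : spectral_norm (invmx A) <= C)
    (hdelta : 0 <= delta) (heps : 0 < eps < 1)
    (theta : Omega -> theta_param R n)
    (htheta : forall w : Omega,
      delta_minimizer (theta_set R n C)
        (empirical_loss P (fun i => invmx A *m y i w) (fun i => y i w))
        delta (theta w)) :
  exists E : set Omega,
    [/\ measurable E,
        ((1 - eps)%:E <= Pr E)%E &
        forall w : Omega, E w ->
          (expected_sqerror A mu (theta w) <=
           (spectral_norm (A *m (invmx P *m invmx P)) *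
            (108 * n%:R * C ^+ 2 * frobenius_norm P ^+ 2 / Num.sqrt N%:R
             + 9 * C ^+ 2 * spectral_norm P ^+ 2
                 * Num.sqrt (2 * ln (2 / eps) / N%:R)
             + delta))%:E)%E].
Proof.
have [y0 y01] : exists y0 : 'cV[R]_n, norm2 y0 = 1.
  have [[v v1]|/nonemptyPn S0] := pselect (unit_sphere R n !=set0); first by exists v.
  by move: hmu; rewrite S0 measure0 => -[] /esym/eqP; rewrite oner_eq0.
have y0n0 : y0 != 0.
  by apply: contra_eq_neq y01 => ->; rewrite norm20 eq_sym oner_eq0.
have n0 : (0 < n)%N.
  case: (n) y0 y01 {y0n0} => // v; rewrite /norm2 big_ord0 sqrtr0 => /eqP.
  by rewrite eq_sym oner_eq0.
have C0 : 0 < C.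
  exact: lt_le_trans (spectral_norm_gt0 (spdmx_invmx_neq0 hA y0n0)) hC.
have P0 : 0 < spectral_norm P.
  apply: (spectral_norm_gt0 (v := y0)); apply: contra y0n0 => /eqP Py0.
  by rewrite -(mul1mx y0) -(mulVmx hPinv) -mulmxA Py0 mulmx0.
set B := invmx A in hC htheta *.
pose K := {ffun 'I_n -> 'I_(2 * N).+1}.
pose F : K -> set (borelRn R n) := @gridcell R n N.
have mF k : measurable (F k) by exact: measurable_gridcell.
have tF : trivIset setT F by exact: trivIset_gridcell.
pose p k := fine (mu (F k)).
have pE k : mu (F k) = (p k)%:E by rewrite fineK // fin_num_measure.
have p0 k : 0 <= p k by rewrite fine_ge0.
have p1 : \sum_k p k = 1.
  apply: EFin_inj; rewrite -sumEFin -hmu -(bigcup_gridcell N).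
  rewrite (_ : \bigcup_k gridcell k = \bigcup_(k in [set k | xpredT k]) F k); last first.
    by congr (\bigcup_(k in _) _); apply/seteqP; split.
  by rewrite measure_finite_bigcup //; apply: eq_bigr => k _; exact/esym/pE.
pose rep (k : K) : 'cV[R]_n := xget y0 (F k).
have repF k v : F k v -> F k (rep k) by move=> Fv; apply: xgetPex; exists v.
have rep1 k : norm2 (rep k) = 1.
  by rewrite /rep; case: xgetP => [v _ []|_].
have [good [good_mass good_bound]] :=
  discrete_generalization p0 p1 rep1 hN n0 hC C0 P0 heps.
(* The event only records the cells of the sample: [box z] is a measurable
   rectangle, so independence gives its probability, and the bound holds on it
   for all parameters at once. *)
pose box (z : N.-tuple K) := \bigcap_(i in [set: 'I_N]) (y i @^-1` F (tnth z i)).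
have mbox z : measurable (box z).
  apply: fin_bigcap_measurable => [|i _]; first exact: finite_finset.
  by rewrite -[X in measurable X]setTI; exact: measurable_funP.
have box_mass z : Pr (box z) = (\prod_(k <- z) p k)%:E.
  rewrite /box (iid_sample_rectangle (B := fun i => F (tnth z i)) hy) //.
  by rewrite big_tuple -prodEFin; apply: eq_bigr => i _; exact: pE.
have tbox : trivIset setT box.
  move=> z z' _ _ [w [zw z'w]]; apply: eq_from_tnth => i.
  apply: tF => //; exists (y i w); split; [exact: zw|exact: z'w].
exists (\bigcup_(z in [set z | good z]) box z); split.
- by apply: fin_bigcup_measurable => [|z _]; [exact: finite_finset|exact: mbox].
- rewrite measure_finite_bigcup //.
  by rewrite (eq_bigr _ (fun z _ => box_mass z)) sumEFin lee_fin.
move=> w [z /= gz zw].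
have thC : theta_set R n C (theta w) by have [] := htheta w.
set s := spectral_norm (A *m _).
have s0 : 0 <= s by exact: spectral_norm_ge0.
set beta := 9 * C ^+ 2 * _ * _.
(* Lipschitz constant of the loss times the bound on the diameter of a cell *)
pose eta := 18 * C ^+ 2 * spectral_norm P ^+ 2 * (n%:R / N%:R).
have near k u v : F k u -> F k v -> sqloss P B (theta w) u <= sqloss P B (theta w) v + eta.
  move=> Fu Fv; have [u1 _] := Fu; have [v1 _] := Fv.
  apply: (le_trans (sqloss_lipschitz (P := P) hC thC u1 v1)); rewrite lerD2l.
  have c0 : 0 <= 18 * C ^+ 2 * spectral_norm P ^+ 2.
    by rewrite mulr_ge0 ?sqr_ge0 // mulr_ge0 ?sqr_ge0.
  by rewrite ler_wpM2l //; exact: gridcell_diameter hN Fu Fv.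
have fit : N%:R^-1 * (\sum_(k <- z) sqloss P B (theta w) (rep k)) <= delta + eta.
  apply: (@le_trans _ _ (N%:R^-1 * (\sum_(i < N) sqloss P B (theta w) (y i w) + N%:R * eta))).
    rewrite ler_wpM2l ?invr_ge0 // big_tuple.
    have -> : N%:R * eta = \sum_(i < N) eta by rewrite sumr_const card_ord mulr_natl.
    rewrite -big_split; apply: ler_sum => i _.
    have yF : F (tnth z i) (y i w) by exact: zw.
    exact: (near _ _ _ (repF _ _ yF) yF).
  rewrite mulrDr mulKf ?pnatr_eq0 -?lt0n // lerD2r.
  exact: (delta_minimizer_loss hC (htheta w)).
apply: (@le_trans _ _ (\sum_k (s * (sqloss P B (theta w) (rep k) + eta))%:E * mu (F k))%E).
  have mg := measurable_sqnorm_error A B (theta w).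
  have sphereC0 : mu (~` unit_sphere R n) = 0%E.
    by rewrite probability_setC ?hmu ?subee //; exact: measurable_sphere.
  rewrite /expected_sqerror.
  apply: (integral_le_partition (mu := mu) (D := unit_sphere R n) _ _ _ mF tF mg
    (c := fun k => s * (sqloss P B (theta w) (rep k) + eta))).
  - exact: measurable_sphere.
  - exact: sphereC0.
  - by rewrite -(bigcup_gridcell N).
  - move=> v; set x := _ - _; have [->|x0] := eqVneq x 0.
      by rewrite /sqnorm_mx mulmx0 mxE.
    by apply/ltW; case: hA => _; apply.
  - move=> k v Fv; apply: (le_trans (sqnorm_mx_le _ (proj1 hA) hPsym hPinv)).
    by rewrite ler_wpM2l //; exact: (near _ _ _ Fv (repF _ _ Fv)).
rewrite (eq_bigr (fun k => (s * (sqloss P B (theta w) (rep k) + eta) * p k)%:E)); last first.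
  by move=> k _; rewrite [RHS]EFinM; congr (_ * _)%E; exact: pE.
rewrite sumEFin lee_fin.
have -> : \sum_k s * (sqloss P B (theta w) (rep k) + eta) * p k =
    s * (\sum_k p k * sqloss P B (theta w) (rep k) + eta).
  rewrite -[X in _ = _ * (_ + X)]mul1r -p1 mulr_suml -big_split mulr_sumr.
  by apply: eq_bigr => k _; rewrite /=; ring.
rewrite ler_wpM2l //.
have := good_bound z gz (theta w) thC; rewrite -/beta => gen.
set Q := n%:R * C ^+ 2 * frobenius_norm P ^+ 2 / Num.sqrt N%:R.
have eta2 : eta <= 18 * Q.
  have SF : spectral_norm P ^+ 2 <= frobenius_norm P ^+ 2.
    by rewrite lerXn2r ?nnegrE ?spectral_norm_ge0 ?sqrtr_ge0 ?spectral_le_frobenius.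
  have NR0 : 0 < N%:R :> R by rewrite ltr0n.
  have sq1 : 1 <= Num.sqrt N%:R :> R by rewrite -[leLHS]sqrtr1 ler_wsqrtr // ler1n.
  have sqN : N%:R^-1 <= (Num.sqrt N%:R)^-1 :> R.
    rewrite lef_pV2 ?posrE ?sqrtr_gt0 // -{2}(sqr_sqrtr (ltW NR0)) expr2.
    by rewrite ler_peMr ?sqrtr_ge0.
  have -> : eta = 18 * (n%:R * C ^+ 2 * spectral_norm P ^+ 2 / N%:R) by rewrite /eta; ring.
  have nC0 : 0 <= n%:R * C ^+ 2 by rewrite mulr_ge0 ?sqr_ge0.
  by rewrite ler_wpM2l // ler_pM ?invr_ge0 // ?ler_wpM2l // mulr_ge0 ?sqr_ge0.
have Q0 : 0 <= Q by rewrite divr_ge0 ?sqrtr_ge0 // mulr_ge0 ?sqr_ge0 // mulr_ge0 ?sqr_ge0.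
have QE c : c * n%:R * C ^+ 2 * frobenius_norm P ^+ 2 / Num.sqrt N%:R = c * Q.
  by rewrite /Q; ring.
(* [69 + 2 * 18 <= 108]: the complexity term, and one discretisation error for
   each of the expected and the empirical loss *)
by move: gen fit; rewrite !QE => *; lra.
Qed.
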